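(* Let $d>6$ and let $\mathsf{E}(\mathbb{Z}^d)$ be either the nearest-neighbor or the spread-out edge set, and suppose that the critical two-point function estimates hold: there are constants $C>c>0$ with $c|x|^{2-d}\le \mathbb{P}_{p_c}(0\leftrightarrow x)\le C|x|^{2-d}$ for all $x\in\mathbb{Z}^d$. Let $\{0\leftrightarrow\infty\}$ be the event that the open cluster of the origin is unbounded, and let $\nu$ be the incipient infinite cluster measure. Then $$\lim_{p\searrow p_c}\mathbb{P}_p(\,\cdot\mid 0\leftrightarrow\infty)=\nu(\cdot),$$ where the limit is in the sense of weak convergence of probability measures on $\{0,1\}^{\mathsf{E}(\mathbb{Z}^d)}$.
   Context: The nearest-neighbor edge set is $\{\{x,y\}:\|x-y\|_1=1\}$; the spread-out edge set with parameter $\Lambda\ge 1$ is $\{\{x,y\}:0<\|x-y\|_\infty\le\Lambda\}$. $\mathbb{P}_p$ is the product measure on $\{0,1\}^{\mathsf{E}(\mathbb{Z}^d)}$ (product topology) under which the coordinates $\omega_e$ are i.i.d. Bernoulli$(p)$; an edge $e$ is open if $\omega_e=1$. $p_c\in(0,1)$ is the critical probability: $p_c=\inf\{p:\mathbb{P}_p(\text{the open cluster of }0\text{ is infinite})>0\}$. $|\cdot|$ is the Euclidean norm, with the convention $|0|^{a}=1$ for negative $a$. $B(n)=[-n,n]^d\cap\mathbb{Z}^d$. $x\leftrightarrow y$ means that $x$ and $y$ are joined by a path of open edges. For $A\subseteq\mathbb{Z}^d$, $x\xleftrightarrow{A}V$ means that $x$ is joined to some vertex of $V$ by a path of open edges all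 of whose vertices lie in $A$. The incipient infinite cluster measure $\nu$ is the weak limit $$\nu(\cdot)=\lim_{n\to\infty}\mathbb{P}_{p_c}\big(\,\cdot\mid 0\xleftrightarrow{\mathbb{Z}^d\setminus D_n}V_n\big),$$ where $V_n,D_n\subseteq\mathbb{Z}^d$ $(n\ge1)$ are any sets such that $(V_n\cup D_n)\cap B(n)=\varnothing$ and such that $0$ and some vertex of $V_n$ lie in the same connected component of the graph $\mathbb{Z}^d\setminus D_n$. Under the stated assumptions this limit exists for every such choice of $(V_n,D_n)$ and does not depend on the choice (for instance one may take $V_n=\{n e_1\}$ with $n$ replaced by $n+1$ if needed to be outside $B(n)$, and $D_n=\varnothing$). *)

(* Defs.v *)
From HB Require Import structures.
From mathcomp Require Import all_boot all_order all_algebra finmap.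
From mathcomp Require Import all_classical all_reals all_analysis.
Set Implicit Arguments.
Unset Strict Implicit.
Unset Printing Implicit Defensive.
Import Order.TTheory GRing.Theory Num.Theory.
Import numFieldNormedType.Exports.
Local Open Scope classical_set_scope.
Local Open Scope ring_scope.

Notation Zd d := 'rV[int]_d (only parsing).

Definition norm1 d (x : Zd d) : nat := (\sum_(i < d) `|x ord0 i|)%N.

Definition norm_infty d (x : Zd d) : nat := (\max_(i < d) `|x ord0 i|)%N.

Definition norm2 (R : realType) d (x : Zd d) : R :=
  Num.sqrt (\sum_(i < d) (x ord0 i)%:~R ^+ 2).

(* |x|^a, with |0|^a = 1; only used for a < 0 *)
Definition norm2_pow (R : realType) d (x : Zd d) (a : int) : R :=
  if x == 0 then 1 else norm2 R x ^ a.

Definition box d (n : nat) : set (Zd d) := [set x | (norm_infty x <= n)%N].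

Arguments box : clear implicits.

Definition nearest_neighbor d : set {fset Zd d} :=
  [set e | exists x y : Zd d, norm1 (x - y) = 1%N /\ e = [fset x; y]%fset].

Definition spread_out (R : realType) d (Lambda : R) : set {fset Zd d} :=
  [set e | exists x y : Zd d,
     [/\ (0 < norm_infty (x - y))%N, (norm_infty (x - y))%:R <= Lambda
       & e = [fset x; y]%fset]].

Arguments nearest_neighbor : clear implicits.
Arguments spread_out {R} d Lambda.

Definition config d (E : set {fset Zd d}) : Type := E -> bool.

Section config_structures.
Context d (E : set {fset Zd d}).

HB.instance Definition _ := Pointed.copy (config E) (E -> bool).
HB.instance Definition _ :=
  Topological.copy (config E) {ptws E -> bool}.

Definition coordinate_events : set (set (config E)) :=
  [set A | exists (e : E) (b : bool), A = [set w | w e = b]].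

(* product sigma-algebra; it equals the Borel sigma-algebra, as E is countable *)
HB.instance Definition _ :=
  Measurable.copy (config E) (g_sigma_algebraType coordinate_events).

End config_structures.

Lemma measurable_countable_bigcup disp (T : measurableType disp)
    (I : countType) (P : set I) (F : I -> set T) :
  (forall i, measurable (F i)) -> measurable (\bigcup_(i in P) F i).
Proof.
move=> mF; rewrite bigcup_mkcond; apply: countable_bigcupT_measurable => //.
by move=> i; case: ifP.
Qed.

Section connectivity.
Context d (E : set {fset Zd d}).
Implicit Types (w : config E) (x y : Zd d) (A V : set (Zd d)).

Definition open_edge w : rel (Zd d) :=
  fun x y => `[< exists e : E, val e = [fset x; y]%fset /\ w e = true >].

Definition all_open : config E := fun _ : E => true.

Definition joined w A x y : Prop :=
  exists s : seq (Zd d),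
    [/\ path (open_edge w) x s, last x s = y & forall z, z \in x :: s -> A z].

Definition joined_set w A x V : Prop := exists2 y, V y & joined w A x y.

Definition cluster w x : set (Zd d) := [set y | joined w setT x y].

Definition unbounded A : Prop := forall n, exists2 x, A x & ~ box d n x.

Definition connect_event x y : set (config E) := [set w | joined w setT x y].

Definition connect_in_event A V : set (config E) := [set w | joined_set w A 0 V].

Definition infinity_event : set (config E) := [set w | unbounded (cluster w 0)].

Lemma measurable_open_edge x y : measurable [set w | open_edge w x y].
Proof.
have [exy|nexy] := pselect (exists e : E, val e = [fset x; y]%fset).
  case: exy => e0 e0E.
  rewrite (_ : [set w | _] = [set w : config E | w e0 = true]).
    by apply: sub_sigma_algebra; exists e0, true.
  apply/seteqP; split=> w /=.
    by move=> /asboolP [e [eE we]]; rewrite (val_inj (etrans e0E (esym eE))).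
  by move=> we; apply/asboolP; exists e0.
rewrite (_ : [set w | _] = set0); first exact: measurable0.
apply/seteqP; split=> w //= /asboolP [e [eE _]].
by apply: nexy; exists e.
Qed.

Lemma measurable_path x (s : seq (Zd d)) :
  measurable [set w | path (open_edge w) x s].
Proof.
elim: s x => [|y s IHs] x /=.
  rewrite (_ : [set w | _] = setT); first exact: measurableT.
  by apply/seteqP; split.
rewrite (_ : [set w | _] =
  [set w | open_edge w x y] `&` [set w | path (open_edge w) y s]).
  by apply: measurableI => //; exact: measurable_open_edge.
by apply/seteqP; split=> w /= => [/andP[]|[-> ->]].
Qed.

Lemma measurable_joined A x y : measurable [set w | joined w A x y].
Proof.
rewrite (_ : [set w | _] =
  \bigcup_(s in [set s | last x s = y /\ forall z, z \in x :: s -> A z])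
    [set w | path (open_edge w) x s]).
  by apply: measurable_countable_bigcup => s; exact: measurable_path.
apply/seteqP; split=> w /=.
  by move=> [s [ps ls As]]; exists s.
by move=> [s [ls As] ps]; exists s.
Qed.

Lemma measurable_connect_in A V : measurable (connect_in_event A V).
Proof.
rewrite (_ : connect_in_event A V =
  \bigcup_(y in V) [set w | joined w A 0 y]).
  by apply: measurable_countable_bigcup => y; exact: measurable_joined.
by apply/seteqP; split=> w /= [y Vy jy]; exists y.
Qed.

Lemma measurable_infinity : measurable infinity_event.
Proof.
rewrite (_ : infinity_event =
  \bigcap_n connect_in_event setT (~` box d n)).
  by apply: bigcap_measurableType => n _; exact: measurable_connect_in.
apply/seteqP; split=> w /=.
  by move=> uw n _; have [y cy by_] := uw n; exists y.
by move=> uw n; have [y by_ cy] := uw n I; exists y.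
Qed.

End connectivity.

Arguments connect_event {d} E x y.
Arguments connect_in_event {d} E A V.
Arguments infinity_event {d} E.
Arguments all_open {d} E.
Arguments measurable_connect_in {d} E A V.
Arguments measurable_infinity {d} E.

(* P (. | B) when P B > 0, and P itself when P B = 0 *)
Definition cond_prob (R : realType) disp (T : measurableType disp)
    (P : probability T R) (B : set T) (mB : measurable B) : probability T R :=
  mnormalize (mrestr P mB) P.

Section percolation.
Context (R : realType) d (E : set {fset Zd d}).

(* the product measure, characterized by its values on finite-dimensional
   rectangles *)
Definition bernoulli_product (p : R) (P : probability (config E) R) : Prop :=
  forall (J : {fset E}) (B : E -> set bool),
    P [set w | forall e, e \in J -> B e (w e)] =
    (\prod_(e <- J) bernoulli_prob p (B e))%E.

Definition critical_probability (P : R -> probability (config E) R) : R :=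
  inf [set p | 0 <= p <= 1 /\
     (0 < P p [set w | infinite_set (cluster w 0)])%E].

Definition two_point_estimates (P : probability (config E) R) : Prop :=
  exists c C : R, 0 < c < C /\
    forall x : Zd d,
      ((c * norm2_pow R x (2 - d%:Z))%:E <= P (connect_event E 0 x) <=
       (C * norm2_pow R x (2 - d%:Z))%:E)%E.

Definition weak_cvg (I : Type) (F : set_system I)
    (mu : I -> probability (config E) R) (nu : probability (config E) R) : Prop :=
  forall f : config E -> R, continuous f -> bounded_fun f ->
    (\int[mu i]_w f w)%R @[i --> F] --> (\int[nu]_w f w)%R.

(* connectivity in the graph Z^d \ D is connectivity inside ~` D when all the
   edges are open *)
Definition admissible (V D : nat -> set (Zd d)) : Prop :=
  forall n, (1 <= n)%N ->
    (V n `|` D n) `&` box d n = set0 /\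
    joined_set (all_open E) (~` D n) 0 (V n).

Definition iic (Pc nu : probability (config E) R) : Prop :=
  forall V D : nat -> set (Zd d), admissible V D ->
    weak_cvg \oo
      (fun n => cond_prob Pc (measurable_connect_in E (~` D n) (V n))) nu.

End percolation.

(* Main.v *)
Require Import Defs.
From mathcomp Require Import all_boot all_order all_algebra finmap.
From mathcomp Require Import all_classical all_reals all_analysis.
From mathcomp Require Import measurable_realfun lra ring zify.
Import Order.TTheory GRing.Theory Num.Theory.
Import numFieldNormedType.Exports.
Local Open Scope classical_set_scope.
Local Open Scope ring_scope.
Set Implicit Arguments.
Unset Strict Implicit.
Unset Printing Implicit Defensive.

(* It suffices to treat a cylinder event F.  As the limit nu is the same for
   all choices of (V_n, D_n), it is uniform: P_pc(F, 0 <-> V off D) is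
   nu(F) P_pc(0 <-> V off D) up to a small relative error as soon as V and D
   avoid a large box.

   If P_pc(0 <-> oo) > 0, this and the continuity in p of the probabilities of
   local events are enough.

   Otherwise let k << m << M, with p close to pc depending on m but not on M.
   Reveal the set a of the vertices outside box k that are joined to the
   complement of box M without using box k, and the set u of the vertices of
   box k with an open edge to a.  Then 0 escapes from box M iff 0 <-> u off a,
   and this depends on unrevealed edges only.  Restricting the latter
   connection to box m costs at most P_p(0 escapes from box m), which is close
   to P_pc(0 <-> oo) = 0, and brings us to a local event, for which p can be
   replaced by pc.  The error only counts when u is nonempty, and
   P_p(u nonempty) <= C(k) P_p(0 escapes from box M) by opening all the edges
   of box k.  So the error is relative, and M can go to infinity.

   The two-point estimates are only used to get 0 < pc < 1. *)

(** * Open paths and exploration *)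

Section paths.
Context d (E : set {fset Zd d}).
Implicit Types (w : config E) (x y z u v : Zd d) (A B V : set (Zd d)).

Lemma joined_refl w A x : A x -> joined w A x x.
Proof. by move=> Ax; exists [::]; split=> // z; rewrite inE => /eqP ->. Qed.

Lemma joined_cons w A x z y :
  A x -> open_edge w x z -> joined w A z y -> joined w A x y.
Proof.
move=> Ax xz [s [ps ls As]]; exists (z :: s); split => //=; first by rewrite xz.
by move=> t; rewrite inE => /orP[/eqP -> //|]; exact: As.
Qed.

(** Induction along an open path, starting from its endpoint [y]; later arguments use it in place of
    the list of vertices. *)
Lemma joined_elim w A y (Q : Zd d -> Prop) :
  (A y -> Q y) ->
  (forall x z, A x -> open_edge w x z -> joined w A z y -> Q z -> Q x) ->
  forall x, joined w A x y -> Q x.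
Proof.
move=> Qy Qs x [s [ps ls As]]; elim: s x ps ls As => [|z s IHs] x /=.
  by move=> _ -> As; apply: Qy; apply: As; rewrite inE.
move=> /andP[xz ps] ls As.
have As' t : t \in z :: s -> A t by move=> ts; apply: As; rewrite inE ts orbT.
apply: (Qs x z) => //; first by apply: As; rewrite inE eqxx.
  by exists s.
exact: IHs.
Qed.

Lemma joined_inl w A x y : joined w A x y -> A x.
Proof. by case=> s [_ _]; apply; rewrite inE eqxx. Qed.

Lemma joined_inr w A x y : joined w A x y -> A y.
Proof. by apply: joined_elim. Qed.

Lemma joined_trans w A x y z :
  joined w A x y -> joined w A y z -> joined w A x z.
Proof.
move=> xy yz; move: x xy; apply: joined_elim => // x t Ax xt _.
exact: joined_cons.
Qed.

Lemma joined_edge w A x y : A x -> A y -> open_edge w x y -> joined w A x y.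
Proof. by move=> Ax Ay xy; apply: joined_cons xy _ => //;
  exact: joined_refl. Qed.

Lemma joined_rcons w A x z y :
  joined w A x z -> open_edge w z y -> A y -> joined w A x y.
Proof.
move=> xz zy Ay; apply: (joined_trans xz).
by apply: joined_edge => //; exact: joined_inr xz.
Qed.

Lemma joined_sub w w' A B :
  (forall x y, A x -> A y -> open_edge w x y -> open_edge w' x y) ->
  A `<=` B -> forall x y, joined w A x y -> joined w' B x y.
Proof.
move=> ww' AB x y; move: x; apply: joined_elim.
  by move=> Ay; apply: joined_refl; exact: AB.
move=> x z Ax xz zy; apply: joined_cons; first exact: AB.
by apply: ww' => //; exact: joined_inl zy.
Qed.

Lemma joined_subset w A B x y : A `<=` B -> joined w A x y -> joined w B x y.
Proof. by move=> AB; apply: joined_sub. Qed.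

Lemma first_exit w A B x y : joined w A x y -> B x -> ~ B y ->
  exists u v, [/\ joined w (A `&` B) x u, open_edge w u v, A v & ~ B v].
Proof.
move=> + + nBy; move: x; apply: joined_elim => // x z Ax xz zy IH Bx.
have [Bz|nBz] := pselect (B z); last first.
  by exists x, z; split => //; [exact: joined_refl | exact: joined_inl zy].
have [u [v [zu uv Av nBv]]] := IH Bz.
by exists u, v; split => //; apply: joined_cons xz zu.
Qed.

Definition agree (T : set E) w w' := forall e, T e -> w e = w' e.

(** One implication is enough, since [agree] is symmetric. *)
Definition determined (T : set E) (G : set (config E)) :=
  forall w w', agree T w w' -> G w -> G w'.

(** An edge within the complement of [A] never touches [A]. Independence of what the exploration
    reveals from what it leaves fresh rests on this. *)
Definition within A : set E := [set e : E | forall x, x \in val e -> A x].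

Definition touching A : set E := [set e : E | exists2 x, x \in val e & A x].

Lemma agree_sym T w w' : agree T w w' -> agree T w' w.
Proof. by move=> ww' e Te; rewrite ww'. Qed.

Lemma agree_sub (S T : set E) w w' : S `<=` T -> agree T w w' -> agree S w w'.
Proof. by move=> ST ww' e /ST; exact: ww'. Qed.

Lemma determined_sub (S T : set E) G :
  S `<=` T -> determined S G -> determined T G.
Proof. by move=> ST dG w w' ww'; apply: dG; exact: agree_sub ww'. Qed.

Lemma determinedI T G H : determined T G -> determined T H ->
  determined T (G `&` H).
Proof. by move=> dG dH w w' ww' [Gw Hw]; split;
  [exact: dG ww' _|exact: dH ww' _]. Qed.

Lemma determined_setI (S T : set E) G :
  determined S G -> determined T G -> determined (S `&` T) G.
Proof.
move=> dS dT w w' ww' Gw.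
(* The hybrid [w2] agrees with [w] on [S] and with [w'] on [T], so [G] passes from [w] to [w2] and
   then to [w']. *)
pose w2 : config E := fun e => if `[< S e >] then w e else w' e.
apply: (dT w2) => [e Te|]; last apply: (dS w) => // e Se.
  by rewrite /w2; case: asboolP => // Se; exact: ww'.
by rewrite /w2 asboolT.
Qed.

Lemma open_edge_agree T w w' x y : agree T w w' ->
  (forall e : E, val e = [fset x; y]%fset -> T e) ->
  open_edge w x y -> open_edge w' x y.
Proof.
move=> ww' Txy /asboolP[e [eE we]]; apply/asboolP; exists e; split => //.
by rewrite -ww' //; exact: Txy.
Qed.

Lemma open_edge_within w w' A x y : agree (within A) w w' -> A x -> A y ->
  open_edge w x y -> open_edge w' x y.
Proof.
move=> ww' Ax Ay; apply: open_edge_agree ww' _ => e eE z.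
by rewrite eE !inE => /orP[] /eqP ->.
Qed.

Lemma open_edge_touching w w' A x y : agree (touching A) w w' -> A x \/ A y ->
  open_edge w x y -> open_edge w' x y.
Proof.
move=> ww' Axy; apply: open_edge_agree ww' _ => e eE.
by case: Axy => ?; [exists x|exists y] => //; rewrite eE !inE eqxx ?orbT.
Qed.

Lemma determined_joined A x y : determined (within A) [set w | joined w A x y].
Proof.
move=> w w' ww'; apply: joined_sub => // u v Au Av.
exact: open_edge_within ww' _ _.
Qed.

Lemma determined_joined_set A x V :
  determined (within A) [set w | joined_set w A x V].
Proof.
by move=> w w' ww' [y Vy xy]; exists y => //; exact: determined_joined ww' xy.
Qed.

Lemma joined_increasing w w' A x y : (forall e, w e -> w' e) ->
  joined w A x y -> joined w' A x y.
Proof.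
move=> ww'; apply: joined_sub => // u v _ _ /asboolP[e [eE /ww' we]].
by apply/asboolP; exists e.
Qed.

(** * Exploration from a target towards a core that is not entered *)

Section exploration.
Variables (X K Z : set (Zd d)).
Hypotheses (KX : K `<=` X) (ZX : Z `<=` X `\` K).

Definition explored w : set (Zd d) :=
  [set x | joined_set w (X `\` K) x Z].

Definition gates w : set (Zd d) :=
  [set x | K x /\ exists2 y, explored w y & open_edge w x y].

Lemma explored_sub w : explored w `<=` X `\` K.
Proof. by move=> x [z _ /joined_inl]. Qed.

Lemma explored_step w x y : (X `\` K) x -> open_edge w x y -> explored w y ->
  explored w x.
Proof. by move=> XKx xy [z Zz yz]; exists z => //;
  exact: joined_cons xy yz. Qed.

Lemma target_explored w : Z `<=` explored w.
Proof. by move=> z Zz; exists z => //; apply: joined_refl; exact: ZX. Qed.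

(** Cut the path at its first entrance into the explored set. The vertex just before must lie in
    [K], as otherwise it would be explored itself; so it is a gate. *)
Lemma joined_gatesE w x : K x ->
  joined_set w X x Z <-> joined_set w (X `\` explored w) x (gates w).
Proof.
move=> Kx; split=> [[z Zz xz]|[u [Ku [y ya uy]] xu]].
  have nax : ~ explored w x by move=> /explored_sub[_].
  have naz : ~ ~ explored w z by apply; exact: target_explored.
  have [u [v [xu uv Xv /contrapT av]]] :=
    first_exit (B := fun t => ~ explored w t) xz nax naz.
  exists u; last by apply: joined_subset xu => t.
  have [Xu nau] := joined_inr xu.
  split; last by exists v.
  by apply: contrapT => nKu; apply: nau; exact: explored_step uv av.
have [z Zz yz] := ya; exists z => //.
have xu' : joined w X x u by apply: joined_subset xu => t [].
have yz' : joined w X y z by apply: joined_subset yz => t [].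
exact: joined_trans (joined_rcons xu' uy (joined_inl yz')) yz'.
Qed.

(** The explored set behaves like a stopping set: the edges joining it to the rest of [X \ K] are
    closed and touch it, so the edges that do not touch it cannot change it. *)
Lemma explored_agree w w' : agree (touching (explored w)) w w' ->
  explored w' = explored w.
Proof.
move=> ww'; apply/seteqP; split=> x [z Zz].
  move: x; apply: joined_elim; first by move=> _;
    exact: (@target_explored w _ Zz).
  move=> x y XKx xy yz ay; apply: (explored_step _ _ ay) => //.
  by apply: open_edge_touching (agree_sym ww') _ xy; right.
move=> xz; exists z => //; move: x xz; apply: joined_elim.
  exact: joined_refl.
move=> x y XKx xy yz; apply: joined_cons => //.
by apply: open_edge_touching ww' _ xy; right; exists z.
Qed.

Lemma gates_agree w w' : agree (touching (explored w)) w w' ->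
  gates w' = gates w.
Proof.
move=> ww'; rewrite /gates (explored_agree ww').
apply/seteqP; split=> x [Kx [y ay xy]]; split=> //; exists y => //.
  by apply: open_edge_touching (agree_sym ww') _ xy; right.
by apply: open_edge_touching ww' _ xy; right.
Qed.

Lemma explored_within w w' : agree (within X) w w' ->
  explored w' = explored w /\ gates w' = gates w.
Proof.
move=> ww'.
have sub w1 w2 : agree (within X) w1 w2 -> explored w1 `<=` explored w2.
  move=> w12 x [z Zz xz]; exists z => //;
    apply: joined_sub xz => // u v [Xu _] [Xv _].
  exact: open_edge_within w12 _ _.
have aE : explored w' = explored w.
  by apply/seteqP; split; apply: sub => //; exact: agree_sym.
split=> //; rewrite /gates aE.
apply/seteqP; split=> x [Kx [y ay xy]]; split=> //; exists y => //.
  apply: open_edge_within (agree_sym ww') (KX Kx) _ xy.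
  by have [] := explored_sub ay.
apply: open_edge_within ww' (KX Kx) _ xy.
by have [] := explored_sub ay.
Qed.

End exploration.
End paths.

(** * Events determined by finitely many edges *)

Section finite_expectation.
Context (R : realType) d (E : set {fset Zd d}).
Implicit Types (w : config E) (e : E) (s K : seq E) (g h : config E -> R).
Implicit Types (G H : set (config E)) (p q : R).

Definition update w e b : config E := fun e' => if e' == e then b else w e'.

Definition weight p (b : bool) : R := if b then p else 1 - p.

(** This is the mean of [g] when the edges of [s] are redrawn independently with parameter [p] and
    the others keep their state in [w]. The recursive form turns estimates in [p] into inductions on
    [s]. *)
Fixpoint resample p s g w : R :=
  if s is e :: s' then
    p * resample p s' g (update w e true) +
    (1 - p) * resample p s' g (update w e false)
  else g w.

Definition depends (T : set E) g := forall w w', agree T w w' -> g w = g w'.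

Lemma update_agree T w w' e b : agree T w w' ->
  agree (T `|` [set e]) (update w e b) (update w' e b).
Proof.
move=> ww' e' Te'; rewrite /update; case: eqP => // ne.
by case: Te' => [/ww'|/ne].
Qed.

Lemma eq_resample p s g h w : (forall w, g w = h w) ->
  resample p s g w = resample p s h w.
Proof. by move=> gh; elim: s w => //= e s IHs w; rewrite !IHs. Qed.

Lemma resample_cat p s1 s2 g w :
  resample p (s1 ++ s2) g w = resample p s1 (resample p s2 g) w.
Proof. by elim: s1 w => //= e s IHs w; rewrite !IHs. Qed.

Lemma resample_cst p s c w : resample p s (fun=> c) w = c.
Proof. by elim: s w => //= e s IHs w; rewrite !IHs; lra. Qed.

Lemma resampleZr p s g c w :
  resample p s (fun w => g w * c) w = resample p s g w * c.
Proof. by elim: s w => //= e s IHs w; rewrite !IHs; lra. Qed.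

Lemma resampleD p s g h w : resample p s (fun w => g w + h w) w =
  resample p s g w + resample p s h w.
Proof. by elim: s w => //= e s IHs w; rewrite !IHs; lra. Qed.

Lemma resample_sum p s w (I : Type) (r : seq I) (F : I -> config E -> R) :
  resample p s (fun w => \sum_(i <- r) F i w) w =
  \sum_(i <- r) resample p s (F i) w.
Proof.
elim: r => [|i r IHr].
  rewrite big_nil -[RHS](resample_cst p s 0 w); apply: eq_resample => w'.
  by rewrite big_nil.
rewrite big_cons -IHr -resampleD; apply: eq_resample => w'.
by rewrite big_cons.
Qed.

Lemma resample_depends p T s g : depends (T `|` [set` s]) g ->
  depends T (resample p s g).
Proof.
elim: s T => [|e s IHs] T dg w w' ww' /=.
  by apply: dg => e' [/ww'|].
have dg' : depends (T `|` [set e] `|` [set` s]) g.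
  move=> w1 w2 w12; apply: dg => e' Te'; apply: w12.
  case: Te' => [|]; first by left; left.
  by rewrite /= inE => /orP[/eqP ->|]; [left; right|right].
by congr (_ * _ + _ * _); apply: IHs dg' _ _ _; exact: update_agree.
Qed.

Lemma resample_ge0 p s g w : 0 <= p <= 1 -> (forall w, 0 <= g w) ->
  0 <= resample p s g w.
Proof.
move=> /andP[p0 p1] g0; elim: s w => //= e s IHs w.
by rewrite addr_ge0// mulr_ge0// subr_ge0.
Qed.

Lemma resample_le p s g h w : 0 <= p <= 1 -> (forall w, g w <= h w) ->
  resample p s g w <= resample p s h w.
Proof.
move=> /andP[p0 p1] gh; elim: s w => //= e s IHs w.
by rewrite lerD// ler_wpM2l// subr_ge0.
Qed.

Lemma resample_lipschitz p q s g w : 0 <= p <= 1 -> 0 <= q <= 1 ->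
  (forall w, 0 <= g w <= 1) ->
  `|resample p s g w - resample q s g w| <= (size s)%:R * `|p - q|.
Proof.
move=> p01 q01 g01; elim: s w => [|e s IHs] w /=.
  by rewrite subrr normr0 mul0r.
set a1 := resample p s g _; set b1 := resample q s g _.
set a0 := resample p s g _; set b0 := resample q s g _.
have [/ler_normlP[h1 h1'] /ler_normlP[h0 h0']] : `|a1 - b1| <=
  (size s)%:R * `|p - q|
  /\ `|a0 - b0| <= (size s)%:R * `|p - q| by split; exact: IHs.
have B w' : 0 <= resample q s g w' <= 1.
  rewrite resample_ge0//=; last by move=> w2; case/andP: (g01 w2).
  rewrite -(resample_cst q s 1 w'); apply: resample_le => // w2.
  by case/andP: (g01 w2).
have /andP[B1 B1'] : 0 <= b1 <= 1 by exact: B.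
have /andP[B0 B0'] : 0 <= b0 <= 1 by exact: B.
(* The difference splits into the change of the two inner averages and the change of the weights.
   The latter costs at most [|p - q|], as [b0] and [b1] lie between 0 and 1. *)
have -> : p * a1 + (1 - p) * a0 - (q * b1 + (1 - q) * b0) =
   (p * (a1 - b1) + (1 - p) * (a0 - b0)) + (p - q) * (b1 - b0) by ring.
apply: (le_trans (ler_normD _ _)).
rewrite -natr1 [leRHS]mulrDl mul1r lerD//; last first.
  rewrite normrM -[leRHS]mulr1 ler_wpM2l//.
  by apply/ler_normlP; split; lra.
case/andP: p01 => p0 p1.
by apply/ler_normlP; split; nra.
Qed.

Definition config_increasing g :=
  forall w w', (forall e, w e -> w' e) -> g w <= g w'.

Lemma update_le w w' e b : (forall e, w e -> w' e) ->
  forall e', update w e b e' -> update w' e b e'.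
Proof. by move=> ww' e'; rewrite /update; case: eqP => // _; exact: ww'. Qed.

Lemma resample_increasing_config p s g : 0 <= p <= 1 ->
  config_increasing g -> config_increasing (resample p s g).
Proof.
move=> /andP[p0 p1] gi; elim: s => //= e s IHs w w' ww'.
by rewrite lerD// ler_wpM2l// ?subr_ge0//; apply: IHs; exact: update_le.
Qed.

(** A larger parameter moves mass to the open state of each edge, where the inner average of an
    increasing function is larger. *)
Lemma resample_increasing p q s g w : 0 <= p -> p <= q -> q <= 1 ->
  config_increasing g -> resample p s g w <= resample q s g w.
Proof.
move=> p0 pq q1 gi; elim: s w => //= e s IHs w.
have i1 := IHs (update w e true); have i0 := IHs (update w e false).
have : resample q s g (update w e false) <= resample q s g (update w e true).
  apply: resample_increasing_config => //; first by rewrite q1 (le_trans p0).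
  by move=> e'; rewrite /update; case: eqP.
nra.
Qed.

Definition cylinder K w : set (config E) := [set w' | agree [set` K] w w'].

Section product_measure.
Variables (p : R) (Pr : probability (config E) R).
Hypotheses (p01 : 0 <= p <= 1) (bPr : bernoulli_product p Pr).

Lemma measurable_cylinder K w : measurable (cylinder K w).
Proof.
elim: K => [|e K IHK].
  by rewrite (_ : cylinder _ _ = setT)//; apply/seteqP; split.
rewrite (_ : cylinder _ _ = [set w' | w' e = w e] `&` cylinder K w).
  apply: measurableI => //; apply: sub_sigma_algebra; by exists e, (w e).
apply/seteqP; split=> w' /= ww'.
  split; first by rewrite ww'//= inE eqxx.
  by move=> e' /= eK; apply: ww' => /=; rewrite inE eK orbT.
by move=> e' /=; rewrite inE => /orP[/eqP ->|]; case: ww' => // _; apply.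
Qed.

Lemma bernoulli_prob_set1 b : bernoulli_prob p [set b] = (weight p b)%:E.
Proof.
rewrite /bernoulli_prob p01 fsbig_set1 /weight.
by case: b.
Qed.

Lemma prob_cylinder K w : uniq K ->
  Pr (cylinder K w) = (\prod_(e <- K) weight p (w e))%:E.
Proof.
move=> uK; have := bPr [fset e in K]%fset (fun e => [set w e]).
rewrite (_ : [set w' | _] = cylinder K w); last first.
  apply/seteqP; split=> w' /= ww' e eK; first by rewrite ww'//= !inE.
  by rewrite ww'//; move: eK; rewrite !inE.
move=> ->; rewrite (perm_big K) /=; last first.
  by apply: uniq_perm => [|//|e]; [exact: fset_uniq|rewrite !inE].
elim: K {uK} => [|e K IHK]; first by rewrite !big_nil.
by rewrite !big_cons IHK bernoulli_prob_set1 EFinM.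
Qed.

Lemma weight_update w e b K : e \notin K ->
  \prod_(e' <- e :: K) weight p (update w e b e') =
  weight p b * \prod_(e' <- K) weight p (w e').
Proof.
move=> eK; rewrite big_cons /update eqxx; congr (_ * _).
rewrite [LHS]big_seq [RHS]big_seq; apply: eq_bigr => e' e'K.
by case: eqP => // ee'; move: eK; rewrite -ee' e'K.
Qed.

Lemma cylinder_split K w e : e \notin K ->
  cylinder K w = cylinder (e :: K) (update w e true) `|`
                 cylinder (e :: K) (update w e false).
Proof.
move=> eK; apply/seteqP; split=> w' /=.
  move=> ww'.
  have H b : w' e = b -> cylinder (e :: K) (update w e b) w'.
    move=> we e' /=; rewrite inE /update; case: eqP => [->//|ne /=].
    exact: ww'.
  by case wE : (w' e); [left|right]; exact: H.
by case=> ww' e' /= e'K; rewrite -ww' /= ?inE ?e'K ?orbT// /update;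
  case: eqP => // ee'; move: eK; rewrite -ee' e'K.
Qed.

Lemma cylinder_disjoint K w e :
  cylinder (e :: K) (update w e true) `&` cylinder (e :: K) (update w e false)
  = set0.
Proof.
apply/seteqP; split=> w' //= -[/(_ e) h1 /(_ e) h2].
have := h1; rewrite -h2 /= ?inE ?eqxx//.
by rewrite /update eqxx => /(_ isT).
Qed.

Lemma prob_cylinderI s K w G : uniq (K ++ s) ->
  determined ([set` K] `|` [set` s]) G ->
  measurable (cylinder K w `&` G) /\
  Pr (cylinder K w `&` G) = (Pr (cylinder K w) * (resample p s \1_G w)%:E)%E.
Proof.
elim: s K w => [|e s IHs] K w uKs dG.
  have cst w' : cylinder K w w' -> G w' <-> G w.
    move=> ww'; have ww'' : agree ([set` K] `|` [set` [::]]) w w' by move=>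
      e' [/ww'|].
    by split; apply: dG => //; exact: agree_sym.
  rewrite /= indicE; have [Gw|nGw] := pselect (G w).
    rewrite mem_set// mule1 (_ : _ `&` _ = cylinder K w).
      by split => //; exact: measurable_cylinder.
    by apply/seteqP; split=> w' => [[]//|ww']; split=> //; apply/(cst w').
  rewrite memNset// mule0 (_ : _ `&` _ = set0).
    by split => //; rewrite measure0.
  by apply/seteqP; split=> w' //= -[/cst h /h].
have eK : e \notin K.
  by move: uKs; rewrite cat_uniq => /and3P[_ /=]; rewrite negb_or => /andP[].
have uK : uniq K by move: uKs; rewrite cat_uniq => /and3P[].
have u' : uniq ((e :: K) ++ s).
  by rewrite -cat_rcons in uKs; move: uKs; rewrite !cat_uniq rcons_uniq /= eK;
     move=> /and3P[-> h ->]; rewrite andbT; apply: contra h;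
       apply: sub_has => e';
     rewrite /= mem_rcons.
have dG' : determined ([set` e :: K] `|` [set` s]) G.
  apply: determined_sub dG => e' [|]/= h; first by left; rewrite /= inE h orbT.
  by move: h; rewrite inE => /orP[/eqP ->|h]; [left; rewrite /= inE eqxx|right].
have [m1 e1] := IHs (e :: K) (update w e true) u' dG'.
have [m0 e0] := IHs (e :: K) (update w e false) u' dG'.
have -> : cylinder K w `&` G = cylinder (e :: K) (update w e true) `&` G `|`
    cylinder (e :: K) (update w e false) `&` G.
  by rewrite -setIUl -cylinder_split.
split; first exact: measurableU.
rewrite measureU//; last by rewrite setIACA cylinder_disjoint set0I.
have uK1 : uniq (e :: K) by rewrite /= eK.
transitivity ((Pr (cylinder (e :: K) (update w e true)) *
   (resample p s \1_G (update w e true))%:E) +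
   (Pr (cylinder (e :: K) (update w e false)) *
   (resample p s \1_G (update w e false))%:E))%E; first by congr (_ + _)%E.
rewrite !prob_cylinder//= -?EFinM -?EFinD -?EFinM.
rewrite !weight_update// /weight; congr (_%:E).
ring.
Qed.

Lemma measurable_determined s G : uniq s -> determined [set` s] G ->
  measurable G.
Proof.
move=> us dG; have [] := @prob_cylinderI s [::] (fun=> false) G us.
  by apply: determined_sub dG => e; right.
by rewrite (_ : cylinder _ _ = setT) ?setTI//; apply/seteqP; split.
Qed.

Lemma prob_resample s G w : uniq s -> determined [set` s] G ->
  Pr G = (resample p s \1_G w)%:E.
Proof.
move=> us dG; have [] := @prob_cylinderI s [::] w G us.
  by apply: determined_sub dG => e; right.
rewrite (_ : cylinder _ _ = setT) ?setTI//; last by apply/seteqP; split.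
by rewrite probability_setT mul1e.
Qed.

End product_measure.
End finite_expectation.

Section finitely_determined.
Context (R : realType) d (E : set {fset Zd d}).
Implicit Types (w : config E) (e : E) (S T : set E) (G H : set (config E)).
Implicit Types (p q : R) (Pr : probability (config E) R).

Lemma finite_set_uniq (I : choiceType) (A : set I) :
  finite_set A -> exists2 s : seq I, uniq s & A = [set` s].
Proof. by move=> /finite_fsetP[F ->]; exists F; first exact: fset_uniq. Qed.

Lemma bernoulli_measurable S G p Pr : 0 <= p <= 1 -> bernoulli_product p Pr ->
  finite_set S -> determined S G -> measurable G.
Proof.
move=> p01 bPr /finite_set_uniq[s us ->] dG;
  exact: (measurable_determined p01 bPr us dG).
Qed.

(** Uniformity in [G] matters: the bound is later applied to connections off every possible explored
    set at once. *)
Lemma bernoulli_lipschitz S : finite_set S -> exists n : nat,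
  forall p q Pp Pq, 0 <= p <= 1 -> 0 <= q <= 1 ->
  bernoulli_product p Pp -> bernoulli_product q Pq ->
  forall G, determined S G -> `|fine (Pp G) - fine (Pq G)| <= n%:R * `|p - q|.
Proof.
move=> /finite_set_uniq[s us ->];
  exists (size s) => p q Pp Pq p01 q01 bp bq G dG.
rewrite (prob_resample p01 bp (fun=> false) us dG).
rewrite (prob_resample q01 bq (fun=> false) us dG) /=.
apply: resample_lipschitz => // w.
by rewrite indicE; case: (_ \in _); rewrite ?lexx ?ler01.
Qed.

Lemma bernoulli_increasing S G p q Pp Pq : finite_set S -> determined S G ->
  (forall w w', (forall e, w e -> w' e) -> G w -> G w') ->
  0 <= p -> p <= q -> q <= 1 ->
  bernoulli_product p Pp -> bernoulli_product q Pq ->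
  (Pp G <= Pq G)%E.
Proof.
move=> /finite_set_uniq[s us ->] dG iG p0 pq q1 bp bq.
have p01 : 0 <= p <= 1 by rewrite p0 (le_trans pq).
have q01 : 0 <= q <= 1 by rewrite q1 (le_trans p0).
rewrite (prob_resample p01 bp (fun=> false) us dG).
rewrite (prob_resample q01 bq (fun=> false) us dG).
rewrite lee_fin resample_increasing// => w w' ww'.
rewrite !indicE ler_nat; have [/set_mem Gw|//] := boolP (w \in G).
by rewrite mem_set//; exact: iG Gw.
Qed.

(** Redraw [s ++ t] in two stages: averaging over [t] leaves the indicator of [G] as a factor and
    turns that of [H] into a constant. *)
Lemma bernoulli_indep S T G H p Pr : 0 <= p <= 1 -> bernoulli_product p Pr ->
  finite_set S -> finite_set T -> determined S G -> determined T H ->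
  S `&` T = set0 -> Pr (G `&` H) = (Pr G * Pr H)%E.
Proof.
move=> p01 bPr /finite_set_uniq[s us ->] /finite_set_uniq[t ut ->] dG dH ST.
have ust : uniq (s ++ t).
  rewrite cat_uniq us ut andbT /=; apply/hasPn => e et; apply/negP => es.
  by have : set0 e; [rewrite -ST|].
have depI (A : set E) K : determined A K -> depends A (\1_K : config E -> R).
  move=> dK w w' ww'; rewrite !indicE; congr (_%:R : R).
  by congr nat_of_bool; apply/idP/idP => /set_mem Kw; apply/mem_set;
    apply: dK Kw => //; exact: agree_sym.
have dGH : determined [set` s ++ t] (G `&` H).
  apply: determinedI.
    by apply: determined_sub dG => e /=; rewrite mem_cat => ->.
  by apply: determined_sub dH => e /=; rewrite mem_cat => ->; rewrite orbT.
pose w0 : config E := fun=> false.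
rewrite (prob_resample p01 bPr w0 ust dGH) (prob_resample p01 bPr w0 us dG).
rewrite (prob_resample p01 bPr w0 ut dH) -EFinM resample_cat; congr (_%:E).
rewrite -resampleZr; apply: eq_resample => w.
transitivity (resample p t (fun w => \1_H w * \1_G w) w).
  by apply: eq_resample => w'; rewrite indicI mulrC.
have dc : depends set0 (resample p t (\1_H : config E -> R)).
  by apply: resample_depends; rewrite set0U; exact: depI.
rewrite [in RHS](dc w0 w)//.
transitivity (resample p t (fun w' => \1_H w' * \1_G w) w); last first.
  by rewrite resampleZr mulrC.
have : forall w1, agree [set` s] w w1 ->
  resample p t (fun w => \1_H w * \1_G w) w1 =
  resample p t (fun w' => \1_H w' * \1_G w) w1 :> R.
  have st e : e \in t -> ~ e \in s.
    by move=> et es; have : set0 e; [rewrite -ST|].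
  elim: (t) st => [_|e t' IHt st] w1 ww1 /=.
    by congr (_ * _); apply/esym; exact: depI ww1.
  have tt' e' : e' \in t' -> ~ e' \in s.
    by move=> e't; apply: st; rewrite inE e't orbT.
  have up b : agree [set` s] w (update w1 e b).
    move=> e' /= e's; rewrite /update; case: eqP => [ee'|_]; last exact: ww1.
    by have := st e; rewrite inE eqxx -ee' e's => /(_ isT).
  by rewrite !IHt.
exact.
Qed.

Lemma bernoulli_all_open S : finite_set S -> exists n : nat,
  forall p Pr, 0 <= p <= 1 -> bernoulli_product p Pr ->
  Pr [set w | forall e, S e -> w e] = (p ^+ n)%:E.
Proof.
move=> /finite_set_uniq[s us ->]; exists (size s) => p Pr p01 bPr.
have := prob_cylinder p01 bPr (fun=> true) us.
rewrite (_ : cylinder _ _ = [set w | forall e, [set` s] e -> w e]) => [->|].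
  by rewrite /weight big_const_seq count_predT iter_mulr_1.
by apply/seteqP; split=> w h e /h.
Qed.

(** With parameter 0 every redrawn edge is closed, so the average is the value at the closed
    configuration. *)
Lemma bernoulli_zero S G Pr : bernoulli_product 0 Pr -> finite_set S ->
  determined S G -> ~ G (fun=> false) -> Pr G = 0%E.
Proof.
move=> bPr /finite_set_uniq[s us ->] dG nG.
rewrite (prob_resample _ bPr (fun=> false) us dG) ?lexx ?ler01//.
congr (_%:E); elim: s {us dG} => [|e s IHs] /=.
  by rewrite indicE memNset.
rewrite mul0r add0r subr0 mul1r -[RHS]IHs; congr (resample _ _ _ _).
by apply/funext => e'; rewrite /update; case: eqP.
Qed.

Lemma bernoulli_one S G Pr : bernoulli_product 1 Pr -> finite_set S ->
  determined S G -> G (fun=> true) -> Pr G = 1%E.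
Proof.
move=> bPr /finite_set_uniq[s us ->] dG nG.
rewrite (prob_resample _ bPr (fun=> true) us dG) ?lexx ?ler01//.
congr (_%:E); elim: s {us dG} => [|e s IHs] /=.
  by rewrite indicE mem_set.
rewrite subrr mul1r mul0r addr0 -[RHS]IHs; congr (resample _ _ _ _).
by apply/funext => e'; rewrite /update; case: eqP.
Qed.

Lemma finite_configs (s : seq E) : exists ws : seq (config E),
  forall w, exists2 w', w' \in ws & agree [set` s] w w'.
Proof.
elim: s => [|e s [ws IH]]; first by exists [:: point] => w; exists point;
  rewrite ?inE.
exists ([seq update w e true | w <- ws] ++ [seq update w e false | w <- ws])
  => w.
have [w' w'ws ww'] := IH w; exists (update w' e (w e)).
  by rewrite mem_cat; case: (w e);
    rewrite (map_f (fun w => update w e _))// orbT.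
move=> e' /=; rewrite inE /update; case: eqP => [->//|_ /= e's].
exact: ww'.
Qed.

(** As [X] depends on finitely many edges, it takes finitely many values, and the list of these does
    not depend on [p]. *)
Lemma bernoulli_total_probability S (I : eqType) (X : config E -> I) :
  finite_set S -> (forall w w', agree S w w' -> X w = X w') ->
  exists r : seq I, forall p Pr, 0 <= p <= 1 -> bernoulli_product p Pr ->
  forall G, determined S G ->
  fine (Pr G) = \sum_(i <- r) fine (Pr (G `&` [set w | X w = i])).
Proof.
move=> /finite_set_uniq[s us ->] dX; have [ws wsP] := finite_configs s.
exists (undup (map X ws)) => p Pr p01 bPr G dG.
have dGX i : determined [set` s] (G `&` [set w | X w = i]).
  by apply: determinedI => // w w' /= /dX ->.
rewrite (prob_resample p01 bPr (fun=> false) us dG) /=.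
under eq_bigr => i _ do rewrite (prob_resample p01 bPr (fun=>
  false) us (dGX i)) /=.
rewrite -resample_sum; apply: eq_resample => w.
have Xw : X w \in undup (map X ws).
  by rewrite mem_undup; have [w' w'ws /dX ->] := wsP w; exact: map_f.
rewrite (bigD1_seq (X w)) ?undup_uniq//= big1 => [|i iXw].
  rewrite addr0 indicI /= [X in _ * X]indicE mem_set//.
  by rewrite mulr1.
rewrite indicI /= [X in _ * X]indicE memNset ?mulr0// => /= Xi.
by rewrite Xi eqxx in iXw.
Qed.

End finitely_determined.

(** * Weak convergence and cylinders *)

Section weak_convergence.
Context (R : realType) d (E : set {fset Zd d}).
Implicit Types (w : config E) (K : seq E) (f : config E -> R).

Lemma nbhs_cylinder K w : nbhs w (cylinder K w).
Proof.
elim: K => [|e K IHK]; first by apply: filterS filterT.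
have : nbhs w [set w' : config E | w' e = w e].
  apply: (@proj_continuous E (fun=> bool) e w [set w e]).
  exact: discrete_set1.
move: IHK; apply: filterS2 => w' ww' we e' /=.
by rewrite inE => /orP[/eqP ->|]; [rewrite we|exact: ww'].
Qed.

(** The filter generated by the cylinders around [w] converges to [w] in each coordinate, hence in
    the product topology. *)
Lemma nbhs_sub_cylinder w (U : set (config E)) : nbhs w U ->
  exists K, cylinder K w `<=` U.
Proof.
pose F := filter_from [set: seq E] (fun K => cylinder K w).
have FF : Filter F.
  apply: filter_from_filter => [|K1 K2 _ _]; first by exists [::].
  exists (K1 ++ K2) => // w' ww'.
  by split=> e /= eK; apply: ww'; rewrite /= mem_cat eK ?orbT.
have sur e : @proj E (fun=> bool) e @` setT = setT.
  by apply/seteqP; split=> // b _; exists (fun=> b).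
have : F --> w.
  apply/cvg_sup => e; apply/cvg_image; first exact: sur.
  move=> A Aw; exists (@proj E (fun=> bool) e @^-1` A); last first.
    by rewrite image_preimage.
  exists [:: e] => // w' ww'; rewrite /preimage /= /proj -ww' /= ?inE//.
  exact: nbhs_singleton.
by move=> /[apply] -[K _ KU]; exists K.
Qed.

Lemma compact_config : compact [set: config E].
Proof.
have := @tychonoff E (fun=> bool) (fun=> setT) (fun=> bool_compact).
by rewrite (_ : [set _ | _] = setT)//; apply/seteqP; split.
Qed.

(** Compactness: otherwise the bad sets [B K] generate a proper filter, and continuity fails at one
    of its cluster points. *)
Lemma uniform_cylinder f (eps : R) : continuous f -> 0 < eps ->
  exists K, forall w w', agree [set` K] w w' -> `|f w - f w'| <= eps.
Proof.
move=> cf eps0; apply: contrapT => nK.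
pose B K := [set w | exists2 w', agree [set` K] w w' & eps < `|f w - f w'|].
have FF : ProperFilter (filter_from [set: seq E] B).
  apply: filter_from_proper => [|K _].
    apply: filter_from_filter => [|K1 K2 _ _]; first by exists [::].
    exists (K1 ++ K2) => // w [w' ww' e'].
    by split; exists w' => // e /= eK; apply: ww'; rewrite /= mem_cat eK ?orbT.
  apply: contrapT => nB; apply: nK; exists K => w w' ww'.
  by rewrite leNgt; apply/negP => e'; apply: nB; exists w, w'.
have [w0 [_ cl]] := compact_config FF filterT.
have : nbhs w0 [set w | `|f w0 - f w| < eps / 2].
  by have /cvgrPdist_lt := cf w0; apply; rewrite divr_gt0.
move=> /nbhs_sub_cylinder[K KU].
have [w [[w' ww' ffw] w0w]] :=
  cl (B K) (cylinder K w0) (ex_intro2 _ _ K I (fun _ =>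
    id)) (nbhs_cylinder K w0).
have h1 : `|f w0 - f w| < eps / 2 by exact: KU.
have h2 : `|f w0 - f w'| < eps / 2 by apply: KU => e eK; rewrite w0w// ww'.
move: ffw; apply/negP; rewrite -leNgt ltW//.
rewrite (_ : f w - f w' = (f w0 - f w') - (f w0 - f w)); last by ring.
apply: (le_lt_trans (ler_normB _ _)); rewrite [ltRHS](splitr eps) ltrD//.
Qed.

Lemma cylinder_indic_continuous K w : continuous (\1_(cylinder K w)
  : config E -> R).
Proof.
move=> w0; apply/cvgrPdist_lt => eps eps0.
move: (nbhs_cylinder K w0); apply: filterS => w' w0w'.
rewrite (_ : \1__ w0 = \1_(cylinder K w) w' :> R) ?subrr ?normr0//.
rewrite !indicE; congr (_%:R); congr nat_of_bool.
by apply/idP/idP => /set_mem h; apply/mem_set => e eK; rewrite h// w0w'.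
Qed.

Lemma Rintegral_cylinder (mu : probability (config E) R) K w :
  (\int[mu]_x (\1_(cylinder K w) x : R))%R = fine (mu (cylinder K w)).
Proof. by rewrite /Rintegral integral_indic ?setIT//;
  exact: measurable_cylinder. Qed.

Lemma weak_cvg_cylinder (I : Type) (F : set_system I)
    (mu : I -> probability (config E) R) (nu : probability (config E) R) :
  Filter F -> weak_cvg F mu nu -> forall K w,
  fine (mu i (cylinder K w)) @[i --> F] --> fine (nu (cylinder K w)).
Proof.
move=> FF munu K w; rewrite -Rintegral_cylinder.
under eq_fun do rewrite -Rintegral_cylinder.
apply: munu; first exact: cylinder_indic_continuous.
exists 1; split; rewrite ?num_real// => x x1 w' _.
by rewrite /= indicE; case: (_ \in _); rewrite ?normr0 ?normr1; lra.
Qed.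

Lemma depends_simple K f : depends [set` K] f ->
  exists ws : seq (config E),
    forall w, f w = \sum_(w' <- ws) f w' * \1_(cylinder K w') w.
Proof.
(* Closing the edges off [K] gives a single representative for each cylinder on [K], so that no
   cylinder is counted twice in the sum. *)
move=> df; pose tr w : config E := fun e => (e \in K) && w e.
have [ws wsP] := finite_configs K.
exists (undup (map tr ws)) => w.
have trE w1 w2 : agree [set` K] w1 w2 -> tr w1 = tr w2.
  move=> w12; apply/funext => e; rewrite /tr; case: (boolP (e \in K)) => //= eK.
  exact: w12.
have trw w1 : agree [set` K] w1 (tr w1) by move=> e /= eK; rewrite /tr eK.
have trin : tr w \in undup (map tr ws).
  by rewrite mem_undup; have [w' w'ws /trE ->] := wsP w; exact: map_f.
rewrite (bigD1_seq (tr w)) ?undup_uniq//= big_seq_cond big1 ?addr0 => [|w'].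
  by rewrite indicE mem_set ?mulr1; [apply: df|exact: agree_sym].
rewrite mem_undup => /andP[/mapP[w1 _ ->] ne].
rewrite indicE memNset ?mulr0// => h; move/eqP: ne; apply.
by rewrite (trE w (tr w1)); [apply/trE; exact: trw|exact: agree_sym].
Qed.

Lemma depends_measurable K f : depends [set` K] f -> measurable_fun setT f.
Proof.
move=> /depends_simple[ws fE].
rewrite (_ : f = fun w => \sum_(w' <- ws) f w' * \1_(cylinder K w') w);
  last exact/funext.
apply: measurable_sum => w'; apply: measurable_funM => //.
apply: measurable_indic; exact: measurable_cylinder.
Qed.

(** The sigma-algebra is generated by the coordinates rather than by the open sets, so measurability
    is obtained from approximation by functions of finitely many edges. *)
Lemma continuous_config_measurable f : continuous f -> measurable_fun setT f.
Proof.
move=> cf.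
have /choice[K KP] : forall n : nat, exists K, forall w w',
    agree [set` K] w w' -> `|f w - f w'| <= n.+1%:R^-1.
  by move=> n; apply: uniform_cylinder.
pose tr n w : config E := fun e => (e \in K n) && w e.
have trw n w : agree [set` K n] w (tr n w) by move=> e /= eK; rewrite /tr eK.
apply: (@measurable_fun_cvg _ _ _ _ (fun n w => f (tr n w))) => [n|w _].
  apply: (@depends_measurable (K n)) => w w' ww'; congr f.
  by apply/funext => e; rewrite /tr; case: (boolP (e \in K n)) => //= eK;
    exact: ww'.
apply/cvgrPdist_le => eps eps0.
near=> n; apply: (le_trans (KP n _ _ (trw n w))).
apply/ltW; near: n; exact: (near_infty_natSinv_lt (PosNum eps0)).
Unshelve. all: end_near. Qed.

(** Up to [eps / 3] uniformly, [f] is a function [g] of finitely many edges, whose integral is a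
    finite combination of cylinder probabilities. *)
Lemma cylinder_weak_cvg (I : Type) (F : set_system I)
    (mu : I -> probability (config E) R) (nu : probability (config E) R) :
  Filter F ->
  (forall K w,
    fine (mu i (cylinder K w)) @[i --> F] --> fine (nu (cylinder K w))) ->
  weak_cvg F mu nu.
Proof.
move=> FF munu f cf bf.
have intf (m : probability (config E) R) (g : config E -> R)
  : measurable_fun setT g ->
    bounded_fun g -> m.-integrable setT (EFin \o g).
  move=> mg bg; apply: measurable_bounded_integrable => //.
  by apply: le_lt_trans (probability_le1 m measurableT) _; rewrite ltry.
apply/cvgrPdist_le => eps eps0.
have e30 : 0 < eps / 3 by rewrite divr_gt0.
have [K KP] := uniform_cylinder cf e30.
pose g w := f (fun e => (e \in K) && w e).
have dg : depends [set` K] g.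
  move=> w w' ww'; congr f; apply/funext => e.
  by case: (boolP (e \in K)) => //= eK; exact: ww'.
have mf := continuous_config_measurable cf.
have mg := depends_measurable dg.
have bg : bounded_fun g.
  by case: bf => M [Mr MP]; exists M; split => // x Mx w _; exact: MP.
have fg (m : probability (config E) R) :
    `|(\int[m]_w f w)%R - (\int[m]_w g w)%R| <= eps / 3.
  rewrite -RintegralB//; [|exact: intf|exact: intf].
  have ifg : m.-integrable setT (EFin \o (fun w => f w - g w)).
    rewrite (_ : _ \o _ = (EFin \o f) \- (EFin \o g))%E//.
    by apply: integrableB => //; exact: intf.
  apply: (le_trans (le_normr_Rintegral _ ifg)) => //.
  have -> : eps / 3 = (\int[m]_(w in [set: config E]) (eps / 3))%R.
    rewrite Rintegral_cst// -[LHS]mulr1; congr (_ * _).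
    exact: (f_equal fine (esym (probability_setT m))).
  apply: le_Rintegral => //.
  - exact: (integrable_norm ifg).
  - apply: intf; first exact: measurable_cst.
    by exists (eps / 3); split; rewrite ?num_real// => x + w _ /=;
       rewrite gtr0_norm// => /ltW.
  - by move=> w _; apply: KP => e /= ->.
have [ws gE] := depends_simple dg.
have gI (m : probability (config E) R) : (\int[m]_w g w)%R =
    \sum_(w' <- ws) g w' * fine (m (cylinder K w')).
  rewrite /Rintegral.
  under eq_integral => w _ do rewrite gE -sumEFin.
  have ii w' : m.-integrable setT (fun w => (g w' * \1_(cylinder K w') w)%:E).
    under eq_fun do rewrite EFinM.
    apply: integrableZl => //; apply: integrable_indic;
      exact: measurable_cylinder.
  rewrite integral_sum//.
  have Iw w' : (\int[m]_w (g w' * \1_(cylinder K w') w)%:E)%E =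
      (g w' * fine (m (cylinder K w')))%:E.
    under eq_integral do rewrite EFinM.
    have mc : measurable (cylinder K w') by exact: measurable_cylinder.
    rewrite integralZl//; last exact: integrable_indic.
    rewrite integral_indic// setIT EFinM fineK//.
    exact: fin_num_measure.
  under eq_bigr do rewrite Iw.
  by rewrite sumEFin.
have gcvg : (\int[mu i]_w g w)%R @[i --> F] --> (\int[nu]_w g w)%R.
  under eq_fun do rewrite gI.
  rewrite gI; apply: cvg_big => [|w' _]; first exact: add_continuous.
  by apply: cvgMr; exact: munu.
move/cvgrPdist_le : gcvg => /(_ _ e30); apply: filterS => i gi.
have := fg nu; have := fg (mu i).
move: gi; rewrite !ler_norml => /andP[g1 g2] /andP[a1 a2] /andP[b1 b2].
by apply/andP; split; lra.
Qed.

End weak_convergence.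

(** * Boxes and edge sets *)

Section lattice.

Lemma absz_le_dist (a b : int) (n L : nat) :
  (`|a| <= n)%N -> (`|(a - b)%R| <= L)%N -> (`|b| <= n + L)%N.
Proof. lia. Qed.

Context (d : nat).
Implicit Types (x y z : Zd d) (A : set (Zd d)).

Lemma absz_sub_sg (a : int) : a != 0 -> `|(a - (a - Num.sg a))%R|%N = 1%N.
Proof. by case: (sgrP a); lia. Qed.

Lemma boxP n x : box d n x <-> forall i, (`|x ord0 i| <= n)%N.
Proof.
split=> [/bigmax_leqP h i|h]; first exact: h.
by apply/bigmax_leqP => i _; exact: h.
Qed.

Lemma box0 n : box d n 0.
Proof. by apply/boxP => i; rewrite mxE. Qed.

Lemma box_leq m n : (m <= n)%N -> box d m `<=` box d n.
Proof. by move=> mn x /=; move=> /leq_trans; apply. Qed.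

Lemma norm_inftyC x y : norm_infty (x - y) = norm_infty (y - x).
Proof. by apply: eq_bigr => i _; rewrite !mxE distnC. Qed.

Lemma box_near n L x y : box d n x -> (norm_infty (x - y) <= L)%N ->
  box d (n + L) y.
Proof.
move=> /boxP xn /bigmax_leqP xy; apply/boxP => i.
have := xy i isT; rewrite !mxE; exact: absz_le_dist.
Qed.

Lemma finite_box n : finite_set (box d n).
Proof.
pose f (g : 'rV['I_(n + n).+1]_d) : Zd d := \row_j ((g ord0 j)%:Z - n%:Z).
apply: (@sub_finite_set _ _ (range f)) => [x /boxP xn|]; last first.
  exact: finite_image.
exists (\row_j inord (absz (x ord0 j + n%:Z))) => //.
apply/rowP => j; by rewrite !mxE inordK; have := xn j; move: (x ord0 j) => a;
  lia.
Qed.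

Lemma finite_set_box A : finite_set A -> exists n, A `<=` box d n.
Proof.
move=> /finite_fsetP[F ->]; exists (\max_(x <- F) norm_infty x)%N => x /= xF.
by rewrite /box /= (big_rem x)//= leq_maxl.
Qed.

Variable E : set {fset Zd d}.

Lemma finite_within A : finite_set A -> finite_set (within A : set E).
Proof.
move=> /finite_fsetP[F ->].
have : finite_set (val @^-1` [set` fpowerset F] : set E).
  by apply: finite_preimage => // e e' _ _; exact: val_inj.
apply: sub_finite_set => e he; rewrite /preimage /= fpowersetE.
by apply/fsubsetP => x /he.
Qed.

Lemma finite_within_box n : finite_set (within (box d n) : set E).
Proof. exact/finite_within/finite_box. Qed.

Lemma edges_within_box (K : seq E) : exists n, [set` K] `<=` within (box d n).
Proof.
have : finite_set [set x : Zd d | exists2 e, e \in K & x \in val e].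
  rewrite (_ : mkset _ = \bigcup_(e in [set` K]) [set` val e]).
    by apply: bigcup_finite => // e _; exact: finite_fset.
  by apply/seteqP; split=> x [e eK xe]; exists e.
move=> /finite_set_box[n hn]; exists n => e eK x xe.
by apply: hn; exists e.
Qed.

Definition contains_nearest_neighbors := forall x y : Zd d,
  norm1 (x - y) = 1%N -> exists e : E, val e = [fset x; y]%fset.

Lemma box_connected (w : config E) n x :
  contains_nearest_neighbors -> (forall e : E, within (box d n) e -> w e) ->
  box d n x -> joined w (box d n) 0 x.
Proof.
move=> nn wn; have [k] := ubnP (norm1 x); elim: k x => // k IHk x xk xn.
have [->|x0] := eqVneq x 0; first by apply: joined_refl; exact: box0.
have [i xi] : exists i, x ord0 i != 0.
  apply: contrapT => nx; move/eqP: x0; apply; apply/rowP => i; rewrite mxE.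
  by apply: contrapT => /eqP xi; apply: nx; exists i.
(* Moving a nonzero coordinate one unit towards 0 stays in the box and lowers [norm1]. *)
pose y : Zd d := \row_j (if j == i then x ord0 j - Num.sg (x ord0 j)
  else x ord0 j).
have yn : box d n y.
  apply/boxP => j; move/boxP: xn => /(_ j); rewrite mxE; case: eqP => // _.
  by move: (x ord0 j) => a; case: (sgrP a); lia.
have yx : (norm1 y < norm1 x)%N.
  rewrite /norm1 (bigD1 i)//= [X in (_ < X)%N](bigD1 i)//=.
  rewrite (eq_bigr (fun j => `|x ord0 j|%N)) => [|j ji]; last first.
    by rewrite mxE (negbTE ji).
  by rewrite mxE eqxx ltn_add2r; move: xi; move: (x ord0 i) => a;
    case: (sgrP a); lia.
have xy1 : norm1 (x - y) = 1%N.
  rewrite /norm1 (bigD1 i)//= big1 => [|j ji]; last first.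
    by rewrite !mxE (negbTE ji) subrr.
  by rewrite !mxE eqxx addn0; exact: absz_sub_sg.
apply: (@joined_rcons _ _ _ _ _ y) => //.
  by apply: IHk => //; exact: leq_trans yx _.
have [e eE] := nn _ _ xy1; apply/asboolP; exists e; rewrite fsetUC; split => //.
by apply: wn => z; rewrite eE !inE => /orP[] /eqP ->.
Qed.

Definition edge_range L := forall (x y : Zd d) (e : E),
  val e = [fset x; y]%fset -> (norm_infty (x - y) <= L)%N.

Lemma open_edge_range L (w : config E) x y : edge_range L ->
  open_edge w x y -> (norm_infty (x - y) <= L)%N.
Proof. by move=> EL /asboolP[e [eE _]]; exact: EL eE. Qed.

Lemma infinite_clusterE : [set w : config E | infinite_set (Defs.cluster w 0)] =
  infinity_event E.
Proof.
apply/seteqP; split=> w /= h.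
  move=> n; apply: contrapT => hn; apply: h;
    apply: sub_finite_set (finite_box n).
  by move=> x wx; apply: contrapT => nx; apply: hn; exists x.
move=> /finite_set_box[n hn]; have [x wx nx] := h n; apply: nx; exact: hn.
Qed.

Definition escape n : set (config E) :=
  connect_in_event E setT (~` box d n).

Lemma escape_nonincreasing m n : (m <= n)%N -> escape n `<=` escape m.
Proof.
move=> mn w [y ny wy]; exists y => // my; apply: ny; exact: box_leq my.
Qed.

Lemma infinity_eventE : infinity_event E = \bigcap_n escape n.
Proof.
apply/seteqP; split=> w /= h n; first by move=> _; have [y cy ny] := h n;
  exists y.
by have [y ny cy] := h n I; exists y.
Qed.

(** The first vertex of a path outside [box d n] is at distance at most [L] from that box. So
    escaping is a local event. *)
Lemma escape_boxE L n : edge_range L ->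
  escape n = [set w | joined_set w (box d (n + L)) 0 (box d (n + L)
    `\` box d n)].
Proof.
move=> EL; apply/seteqP; split=> w [y ny wy]; last first.
  by exists y; [case: ny|apply: joined_subset wy].
have [u [v [wu uv _ nv]]] := first_exit wy (box0 n) ny.
have [_ nu] := joined_inr wu.
have vL : box d (n + L) v by apply: box_near nu _; exact: open_edge_range uv.
exists v => //; apply: (@joined_rcons _ _ _ _ _ u) => //.
by apply: joined_subset wu => z [_]; apply: box_leq; exact: leq_addr.
Qed.

Lemma determined_escape L n : edge_range L ->
  determined (within (box d (n + L))) (escape n).
Proof. by move=> /escape_boxE ->; exact: determined_joined_set. Qed.

Lemma escape_increasing n (w w' : config E) :
  (forall e, w e -> w' e) -> escape n w -> escape n w'.
Proof. by move=> ww' [y ny wy]; exists y => //;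
  exact: joined_increasing wy. Qed.

End lattice.

(** * The nearest-neighbor and spread-out edge sets *)

Section edge_sets.
Context (d : nat).

Lemma fset2_inj (x y x' y' : Zd d) : [fset x; y]%fset = [fset x'; y']%fset ->
  [\/ x = y, (x = x' /\ y = y') | (x = y' /\ y = x')].
Proof.
move=> /fsetP h; have := h y; have := h x; rewrite !inE !eqxx orbT /=.
move=> /esym/orP[]/eqP -> /esym/orP[]/eqP ->;
  [exact: Or31|exact: Or32|exact: Or33|exact: Or31].
Qed.

Lemma norm_infty_le1 (x : Zd d) : (norm_infty x <= norm1 x)%N.
Proof. by apply/bigmax_leqP => i _; rewrite /norm1 (bigD1 i)//= leq_addr. Qed.

Lemma norm_infty0 : norm_infty (0 : Zd d) = 0%N.
Proof. by apply/eqP; rewrite -leqn0; exact: (@box0 d 0). Qed.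

Lemma norm1_gt0 (x : Zd d) : norm1 x = 1%N -> (0 < norm_infty x)%N.
Proof.
move=> x1; rewrite lt0n; apply/eqP => x0.
have /boxP xi : box d 0 x by rewrite /box /= x0.
have : norm1 x = 0%N.
  by rewrite /norm1 big1// => i _; apply/eqP; rewrite -leqn0; exact: xi.
by rewrite x1.
Qed.

Variable E : set {fset Zd d}.

Lemma range_of_bound L :
  (forall e : E, exists x y, (norm_infty (x - y)%R <= L)%N /\ val e = [fset x;
    y]%fset) ->
  edge_range E L.
Proof.
move=> h x y e eE; have [x' [y' [xy' eE']]] := h e.
have [->|[-> ->]//|[-> ->]] := fset2_inj (etrans (esym eE) eE').
  by rewrite subrr norm_infty0.
by rewrite norm_inftyC.
Qed.

Lemma edge_setP (R : realType) :
  (E = nearest_neighbor d \/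
   exists Lambda : R, 1 <= Lambda /\ E = spread_out d Lambda) ->
  contains_nearest_neighbors E /\ exists L, edge_range E L.
Proof.
case=> [EE|[Lam [Lam1 EE]]]; split.
- move=> x y xy; have Exy : E [fset x; y]%fset by rewrite EE; exists x, y.
  by exists (SigSub (mem_set Exy)).
- exists 1%N; apply: range_of_bound => e.
  have : nearest_neighbor d (val e) by rewrite -EE; exact: set_valP.
  move=> [x [y [xy1 ->]]]; by exists x, y; split => //;
    apply: leq_trans (norm_infty_le1 _) _; rewrite xy1.
- move=> x y xy; have Exy : E [fset x; y]%fset.
    rewrite EE; exists x, y; split => //; first exact: norm1_gt0.
    by apply: le_trans Lam1;
      rewrite (_ : 1 = 1%:R)// ler_nat (leq_trans (norm_infty_le1 _))// xy.
  by exists (SigSub (mem_set Exy)).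
- exists (Num.truncn Lam); apply: range_of_bound => e.
  have : spread_out d Lam (val e) by rewrite -EE; exact: set_valP.
  move=> [x [y [_ xyL ->]]]; by exists x, y; split => //;
    rewrite truncn_ge_nat // (le_trans ler01).
Qed.

End edge_sets.

(** * Conditional probabilities and the incipient infinite cluster *)

Section probability_bounds.
Context disp (T : measurableType disp) (R : realType) (Q : probability T R).
Implicit Types A B : set T.

Lemma fine_prob_ge0 A : 0 <= fine (Q A).
Proof. exact/fine_ge0/measure_ge0. Qed.

Lemma fine_prob_le A B : measurable A -> measurable B -> A `<=` B ->
  fine (Q A) <= fine (Q B).
Proof.
move=> mA mB AB; apply: fine_le; rewrite ?fin_num_measure//.
by apply: le_measure; rewrite ?inE.
Qed.

Lemma fine_probU A B : measurable A -> measurable B ->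
  fine (Q (A `|` B)) <= fine (Q A) + fine (Q B).
Proof.
move=> mA mB; rewrite -fineD ?fin_num_measure//.
apply: fine_le; rewrite ?fin_numD ?fin_num_measure//; first exact: measurableU.
exact: measureU2.
Qed.

(** The loss in passing from [C] to [B] is smaller inside [A]. With [escape n] as [C] and
    [infinity_event] as [B], this bounds [A] together with infinite connection from below. *)
Lemma fine_prob_setI_le A B C : measurable A -> measurable B -> measurable C ->
  B `<=` C -> fine (Q (A `&` C)) + fine (Q B) <= fine (Q (A `&` B))
    + fine (Q C).
Proof.
move=> mA mB mC BC; have mCB : measurable (C `\` B) by exact: measurableD.
have mAB : measurable (A `&` B) by exact: measurableI.
have -> : fine (Q C) = fine (Q (C `\` B)) + fine (Q B).
  rewrite -fineD ?fin_num_measure// -measureU// ?setDUK//; last first.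
    by rewrite setIC setDIK.
  by rewrite setUC setDUK.
rewrite addrA lerD2r; apply: le_trans (fine_probU mAB mCB).
apply: fine_prob_le; [exact: measurableI|exact: measurableU|].
by move=> x [Ax Cx]; have [Bx|nBx] := pselect (B x); [left|right].
Qed.

Lemma cond_probE A B (mB : measurable B) : measurable A -> 0 < fine (Q B) ->
  fine (cond_prob Q mB A) = fine (Q (A `&` B)) / fine (Q B).
Proof.
move=> mA B0; rewrite /cond_prob /= /mnormalize /= /mrestr setTI.
have QB : Q B \is a fin_num by exact: fin_num_measure.
have -> : (Q B == 0)%E = false.
  by apply/negP => /eqP QB0; rewrite QB0 ltxx in B0.
have -> : (Q B == +oo)%E = false by apply/negP => /eqP QBy; rewrite QBy in QB.
by rewrite /= fineM// fin_num_measure//; exact: measurableI.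
Qed.

End probability_bounds.

(** * Infinite connection as a limit of escapes *)

Section escape_limit.
Context (R : realType) (d : nat) (E : set {fset Zd d}).
Variable Q : probability (config E) R.

Lemma measurable_escape n : measurable (escape (E := E) n).
Proof. exact: measurable_connect_in. Qed.

Lemma escape_cvg (A : set (config E)) : measurable A ->
  fine (Q (A `&` escape n)) @[n --> \oo] --> fine (Q (A `&` infinity_event E)).
Proof.
move=> mA; apply: fine_cvg; rewrite fineK; last first.
  by apply: fin_num_measure; apply: measurableI => //;
    exact: measurable_infinity.
have mAe n : measurable (A `&` escape n).
  by apply: measurableI => //; exact: measurable_escape.
rewrite infinity_eventE -bigcapIr; last by exists 0%N.
apply: nonincreasing_cvg_mu => //.
- by apply: le_lt_trans (probability_le1 Q (mAe 0%N)) _; rewrite ltry.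
- exact: bigcap_measurableType.
- move=> m n mn; apply/subsetPset; apply: setIS; exact: escape_nonincreasing.
Qed.

Lemma escape_cvgT :
  fine (Q (escape (E := E) n)) @[n --> \oo] --> fine (Q (infinity_event E)).
Proof.
by have := escape_cvg measurableT; rewrite setTI; under eq_fun do rewrite setTI.
Qed.

End escape_limit.

Section iic_uniform.
Context (R : realType) (d : nat) (E : set {fset Zd d}).
Variables (Q nu : probability (config E) R).
Hypothesis iicQ : iic Q nu.

(* Since the limit is the same for all (V_n, D_n), it is uniform in them. *)
Lemma iic_uniform J w0 (eps : R) : 0 < eps ->
  exists n : nat, forall A V : set (Zd d),
    box d n `<=` A -> V `<=` ~` box d n ->
  `|fine (Q (cylinder J w0 `&` [set w | joined_set w A 0 V])) -
    fine (nu (cylinder J w0)) * fine (Q [set w | joined_set w A 0 V])| <=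
  eps * fine (Q [set w : config E | joined_set w A 0 V]).
Proof.
move=> eps0; apply: contrapT => hn.
(* Otherwise violating pairs, one for each box, form a single admissible sequence along which the
   conditional probabilities stay [eps] away from the limit. *)
have /choice[AV AVP] : forall n : nat, exists AV : set (Zd d) * set (Zd d),
  [/\ box d n `<=` AV.1, AV.2 `<=` ~` box d n &
  eps * fine (Q [set w : config E | joined_set w AV.1 0 AV.2]) <
  `|fine (Q (cylinder J w0 `&` [set w | joined_set w AV.1 0 AV.2])) -
    fine (nu (cylinder J w0)) * fine (Q [set w | joined_set w AV.1 0 AV.2])|].
  move=> n; apply: contrapT => nAV; apply: hn; exists n => A V nA nV.
  by rewrite leNgt; apply/negP => h; apply: nAV; exists (A, V).
pose V n := (AV n).2; pose D n := ~` (AV n).1.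
have DV n : [set w : config E | joined_set w (AV n).1 0 (AV n).2] =
    connect_in_event E (~` D n) (V n).
  by rewrite /D setCK.
have adm : admissible E V D.
  move=> n _; have [nA nV lt] := AVP n; split.
    apply/seteqP; split=> // x [[/nV//|nAx] nx]; exact: nAx (nA x nx).
  (* If [V n] could not be reached even with all edges open, the event would be empty and both sides
     of the strict inequality would be 0. *)
  apply: contrapT => nj; move: lt; rewrite DV.
  have -> : connect_in_event E (~` D n) (V n) = set0.
    apply/seteqP; split=> // w [y Vy wy]; apply: nj; exists y => //.
    exact: joined_increasing wy.
  by rewrite setI0 measure0 /= !mulr0 subr0 normr0 ltxx.
have FF : Filter (\oo : set_system nat) by exact: _.
have := @weak_cvg_cylinder _ _ _ _ _ _ _ FF (iicQ adm) J w0.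
move=> /cvgrPdist_le /(_ _ eps0) [n _ /(_ n (leqnn n))] /=.
have [_ _] := AVP n; rewrite DV => lt; apply/negP; rewrite -ltNge.
set B := connect_in_event _ _ _ in lt *.
have mB : measurable B by exact: measurable_connect_in.
have mC := measurable_cylinder J w0.
(* When the conditioning event is null, [cond_prob] takes its default value and says nothing; but
   then both sides of [lt] vanish. *)
have [B0|B0] := ltP 0 (fine (Q B)); last first.
  have QB0 : fine (Q B) = 0 by apply/eqP; rewrite eq_le B0 fine_prob_ge0.
  move: lt; rewrite QB0 !mulr0 subr0 ger0_norm ?fine_prob_ge0//.
  have := fine_prob_le Q (measurableI _ _ mC mB) mB (@subIsetr _ _ _).
  rewrite QB0; lra.
rewrite cond_probE// -(ltr_pM2r B0); apply: (lt_le_trans lt).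
set q := fine (Q B) in B0 *; set a := fine (Q (_ `&` _)); set c := fine _.
have -> : `|c - a / q| * q = `|(c - a / q)
  * q| by rewrite normrM (gtr0_norm B0).
by rewrite mulrBl divfK ?gt_eqF// distrC.
Qed.

End iic_uniform.

(** * Decoupling by exploration *)

Section exploration_bounds.
Context (R : realType) (d : nat) (E : set {fset Zd d}).
Variables (L : nat) (p : R) (Q : probability (config E) R).
Hypotheses (nnE : contains_nearest_neighbors E) (EL : edge_range E L).
Hypotheses (p01 : 0 <= p <= 1) (bQ : bernoulli_product p Q).

(** The target annulus has width [L], so no edge can jump over it on leaving [box d M]. *)
Let shell k M := explored (E :=
  E) (box d (M + L)) (box d k) (box d (M + L) `\` box d M).
Let doors k M := gates (E :=
  E) (box d (M + L)) (box d k) (box d (M + L) `\` box d M).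

(* Finite energy: once the edges of box k are open, a gate lets 0 escape. *)
Lemma doors_prob_le k M N : (k <= M)%N ->
  Q [set w : config E | forall e, within (box d k) e -> w e] = (p ^+ N)%:E ->
  fine (Q [set w | doors k M w !=set0]) * p ^+ N <= fine (Q (escape M)).
Proof.
move=> kM QN.
have kX : box d k `<=` box d (M + L) by apply: box_leq; lia.
pose fill w : config E := fun e => `[< within (box d k) e >] || w e.
(* [H] ignores the edges inside [box d k], so it is independent of the event that these are all
   open; on that event [fill w] is [w], and [H] becomes [escape M]. *)
pose H := [set w | escape M (fill w)].
pose T : set E := within (box d (M + L)) `\` within (box d k).
have fT : finite_set T by apply: sub_finite_set (finite_within_box E (M + L))
  => e [].
have dH : determined T H.
  move=> w w' ww'; apply: (determined_escape EL) => e eX; rewrite /fill.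
  by case: asboolP => //= ne; exact: ww'.
have fk := finite_within_box E k.
have dO : determined (within (box d k)) [set w : config E | forall e,
  within (box d k) e -> w e].
  by move=> w w' ww' wk e ek; rewrite -ww'//; exact: wk.
have dG : determined (within (box d (M + L))) [set w | doors k M w !=set0].
  move=> w w' ww'; rewrite /= /doors.
  by have [_ ->] := explored_within (box d (M + L) `\` box d M) kX ww'.
have mH := bernoulli_measurable p01 bQ fT dH.
have mO := bernoulli_measurable p01 bQ fk dO.
have mG := bernoulli_measurable p01 bQ (finite_within_box E (M + L)) dG.
have GH : [set w | doors k M w !=set0] `<=` H.
  move=> w [u [uk [y [z [zX nz] yz] uy]]].
  have wf e : w e -> fill w e by rewrite /fill => ->; rewrite orbT.
  exists z => //; apply: (@joined_trans _ _ _ _ _ u).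
    apply: (@joined_subset _ _ _ (box d k)) => //.
    by apply: box_connected => // e ek; rewrite /fill asboolT.
  apply: (@joined_cons _ _ _ _ _ y) => //.
    move/asboolP: uy => [e [eE we]]; apply/asboolP; exists e; split => //.
    exact: wf.
  by apply: joined_increasing wf _; apply: joined_subset yz.
have := fine_prob_le Q mG mH GH =>
  /(ler_wpM2r (exprn_ge0 N (proj1 (andP p01)))).
move=> /le_trans; apply.
have TO : T `&` within (box d k) = set0 by apply/seteqP; split=> // e [[_ ?]].
have QHO := bernoulli_indep p01 bQ fT fk dH dO TO.
have -> : fine (Q H) * p ^+ N =
    fine (Q (H `&` [set w : config E | forall e, within (box d k) e -> w e])).
  by rewrite QHO QN fineM//; exact: fin_num_measure.
apply: fine_prob_le; [exact: measurableI|exact: measurable_escape|].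
move=> w [Hw wO]; suff <- : fill w = w by [].
by apply/funext => e; rewrite /fill; case: asboolP => // /wO ->.
Qed.

(* Given the explored set and the gates, an escape is a connection from 0 to
   the gates through fresh edges; confining it to box m costs at most the
   probability of [escape m], and nothing when there is no gate. *)
Lemma exploration_bound (J : seq E) w0 n m M (c eps kappa : R) :
  [set` J] `<=` within (box d n) -> (n + L <= m)%N -> (m <= M)%N ->
  0 <= c <= 1 -> 0 <= eps -> 0 <= kappa ->
  (forall A V, A `<=` ~` box d (n + L) -> V `<=` ~` box d n ->
    `|fine (Q (cylinder J w0 `&` [set w | joined_set w (box d m `\` A) 0 V])) -
      c * fine (Q [set w | joined_set w (box d m `\` A) 0 V])| <=
    eps * fine (Q [set w | joined_set w (box d m `\` A) 0 V]) + kappa) ->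
  `|fine (Q (cylinder J w0 `&` escape M)) - c * fine (Q (escape M))| <=
  eps * fine (Q (escape M)) +
  (kappa + fine (Q (escape m))) * fine (Q [set w | doors (n + L) M w !=set0]).
Proof.
move=> Jn km mM /andP[c0 c1] eps0 kappa0 hyp; set k := (n + L)%N in km hyp *.
have kX : box d k `<=` box d (M + L) by apply: box_leq; lia.
have ZX : box d (M + L) `\` box d M `<=` box d (M + L) `\` box d k.
  by move=> x [xX nx]; split => // xk; apply: nx; apply: box_leq xk; lia.
set F := cylinder J w0.
set X := box d (M + L) in kX ZX *.
have fX : finite_set (within X : set E) by exact: finite_within_box.
pose obs w := (shell k M w, doors k M w).
have dobs w w' : agree (within X) w w' -> obs w = obs w'.
  by move=> ww'; rewrite /obs /shell /doors -/X;
    have [-> ->] := explored_within (X `\` box d M) kX ww'.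
have dF (A : set (Zd d)) : box d k `<=` A -> determined (within A) F.
  move=> kA w w' ww' Fw e eJ; rewrite Fw// ww'// => x xe.
  by apply: kA; apply: (@box_leq _ n); [exact: leq_addr|exact: (Jn e eJ)].
have dFX := dF X kX.
have dE : determined (within X) (escape (E := E) M) by exact: determined_escape.
have dG : determined (within X) [set w | doors k M w !=set0].
  by move=> w w' /dobs [_ h]; rewrite /= h.
(* Decomposing over the values of the explored set and the gates reduces the bound to one value
   [(a, u)] at a time. *)
have [r rP] := bernoulli_total_probability R fX dobs.
have rQ G dG0 := rP p Q p01 bQ G dG0.
rewrite (rQ _ (determinedI dFX dE)) (rQ _ dE) (rQ _ dG)
  !mulr_sumr -sumrB -big_split /=.
apply: (le_trans (ler_norm_sum _ _ _)); apply: ler_sum => -[a u] _.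
set O := [set w | obs w = (a, u)].
have [[w1 [a1 u1]]|nO] := pselect (exists w, obs w = (a, u)); last first.
  have -> : O = set0 by apply/seteqP; split=> // w wO; apply: nO; exists w.
  by rewrite !setI0 !measure0 /= !mulr0 subr0 normr0 addr0.
have aX : a `<=` X `\` box d k by rewrite -a1; exact: explored_sub.
have uk : u `<=` box d k by rewrite -u1 => x [].
(* This is why [k] is [n + L]: a vertex of [box d n] only has neighbors in [box d k], which is never
   explored, so it is no gate. *)
have un : u `<=` ~` box d n.
  rewrite -u1 => x [_ [y ya xy]] xn; have [_] := explored_sub ya; apply.
  exact: box_near xn (open_edge_range EL xy).
pose B := [set w : config E | joined_set w (X `\` a) 0 u].
have OE : escape M `&` O = B `&` O.
  apply/seteqP; split=> w [Ew Ow]; split=> //; have [aw uw] := Ow.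
    move: Ew; rewrite (escape_boxE M EL) /B /= -aw -uw.
    by move=> /(joined_gatesE ZX w (@box0 d k)).
  rewrite (escape_boxE M EL); apply/(joined_gatesE ZX w (@box0 d k)).
  by move: Ew; rewrite /B /= -aw -uw.
(* The value of the exploration is decided by the edges touching [a]; intersecting with [within X]
   makes the set of edges finite. *)
have dO : determined (touching a `&` within X) O.
  apply: determined_setI => w w' ww'; last by rewrite /O /= (dobs _ _ ww').
  case=> aw uw; rewrite /O /= /obs /shell /doors.
  have ww2 : agree (touching (explored X (box d k) (X `\` box d M) w))
    w w' by rewrite [explored _ _ _ _]aw.
  by rewrite (explored_agree ZX ww2) (gates_agree ZX ww2)
    [explored _ _ _ _]aw [gates _ _ _ _]uw.
have dB : determined (within (X `\` a)) B by exact: determined_joined_set.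
have fB : finite_set (within (X `\` a) : set E).
  by apply: sub_finite_set fX => e eXa x xe; have [] := eXa x xe.
have fO : finite_set (touching a `&` within X : set E).
  by apply: sub_finite_set fX => e [].
have kXa : box d k `<=` X `\` a.
  by move=> x xk; split; [exact: kX|move=> /aX[]].
have dFB : determined (within (X `\` a)) (F `&` B) by apply: determinedI =>
  //; exact: dF.
have disj : within (X `\` a) `&` (touching a `&` within X) = set0 :> set E.
  by apply/seteqP; split=> // e [eXa [[x xe ax] _]]; have [_] := eXa x xe.
have QO : Q O \is a fin_num by apply: fin_num_measure;
  exact: (bernoulli_measurable p01 bQ fO dO).
have mB := bernoulli_measurable p01 bQ fB dB.
have mFB := bernoulli_measurable p01 bQ fB dFB.
have indep G : determined (within (X `\` a)) G ->
    fine (Q (G `&` O)) = fine (Q G) * fine (Q O).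
  move=> dG'; rewrite (bernoulli_indep p01 bQ fB fO dG' dO disj) fineM//.
  by apply: fin_num_measure; exact: (bernoulli_measurable p01 bQ fB dG').
rewrite -setIA OE setIA (indep _ dFB) (indep _ dB).
have O0 : 0 <= fine (Q O) by exact: fine_prob_ge0.
(* Without gates [B] is empty, so this value contributes no error. That is how the probability of a
   nonempty set of gates enters the bound. *)
have [u0|/eqP/set0P[y uy]] := pselect (u = set0).
  have -> : B = set0 by apply/seteqP; split=> // w [y]; rewrite u0.
  rewrite setI0 measure0 /= !mul0r !mulr0 subr0 normr0 add0r.
  by rewrite mulr_ge0 ?addr_ge0 ?fine_prob_ge0 // mulr0.
have -> : [set w | doors k M w !=set0] `&` O = O.
  by apply/seteqP; split=> w; [case|move=> Ow; split=> //; case: (Ow) => _ uw;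
    exists y; rewrite /= uw].
rewrite mulrA -mulrBl (mulrA eps) -mulrDl normrM (ger0_norm O0) ler_wpM2r//.
pose B' := [set w : config E | joined_set w (box d m `\` a) 0 u].
have fB' : finite_set (within (box d m `\` a) : set E).
  by apply: sub_finite_set (finite_within_box E m) => e eXa x xe;
    have [] := eXa x xe.
have dB' : determined (within (box d m `\` a))
  B' by exact: determined_joined_set.
have km' : box d k `<=` box d m `\` a.
  by move=> x xk; split; [exact: box_leq xk|move=> /aX[]].
have dFB' : determined (within (box d m `\` a)) (F `&` B').
  by apply: determinedI => //; exact: dF.
have mB' := bernoulli_measurable p01 bQ fB' dB'.
have mFB' := bernoulli_measurable p01 bQ fB' dFB'.
have me : measurable (escape (E := E) m) by exact: measurable_escape.
have B'B : B' `<=` B.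
  move=> w [z uz wz]; exists z => //; apply: joined_subset wz => x [xm nax].
  by split => //; apply: box_leq xm; lia.
(* If 0 does not escape from [box d m], a connection from 0 never leaves that box and is already
   counted in [B']. *)
have BB' : B `<=` B' `|` escape m.
  move=> w [z uz wz]; have [esc|nesc] := pselect (escape m w); first by right.
  left; exists z => //.
  have stay x : joined w (X `\` a) 0 x -> box d m x.
    move=> wx; apply: contrapT => nx; apply: nesc; exists x => //.
    exact: joined_subset wx.
  suff : forall x, joined w (X `\` a) x z -> joined w (X `\` a) 0 x ->
      joined w (box d m `\` a) x z.
    by apply => //; apply: joined_refl; exact: joined_inl wz.
  apply: joined_elim => [[Xz naz] wz'|x t [Xx nax] xt tz IH wx].
    by apply: joined_refl; split => //; exact: stay.
  apply: (@joined_cons _ _ _ _ _ t) => //; first by split => //; exact: stay.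
  by apply: IH; apply: joined_rcons wx xt _; exact: joined_inl tz.
have h1 := fine_prob_le Q mB' mB B'B.
have h2 : fine (Q B) <= fine (Q B') + fine (Q (escape m)).
  apply: le_trans (fine_probU Q mB' me); apply: fine_prob_le => //.
  exact: measurableU.
have h3 : fine (Q (F `&` B')) <= fine (Q (F `&` B)).
  by apply: fine_prob_le => //; exact: setIS.
have h4 : fine (Q (F `&` B)) <= fine (Q (F `&` B')) + fine (Q (escape m)).
  apply: le_trans (fine_probU Q mFB' me); apply: fine_prob_le => //.
    exact: measurableU.
  by move=> w [Fw /BB'[B'w|]]; [left|right].
have ak : a `<=` ~` box d k by move=> x /aX[].
have := hyp a u ak un; rewrite !ler_norml => /andP[g1 g2].
have q0 : 0 <= fine (Q (escape (E := E) m)) by exact: fine_prob_ge0.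
(* Passing from [B'] to [B] costs the escape probability only once: the upper bound uses [h1] and
   [h4], the lower one [h2] and [h3] with [c <= 1]. *)
apply/andP; split; nra.
Qed.

End exploration_bounds.

(** * The limit from the right at the critical point *)

Section right_limit.
Context (R : realType) (d : nat) (E : set {fset Zd d}).
Variables (L : nat) (P : R -> probability (config E) R).
Variables (nu : probability (config E) R) (pc : R).
Hypotheses (nnE : contains_nearest_neighbors E) (EL : edge_range E L).
Hypothesis bP : forall p : R, 0 <= p <= 1 -> bernoulli_product p (P p).

Let theta p := fine (P p (infinity_event E)).

Lemma escape_limit_le (Q : probability (config E) R) (A : set (config E))
    (c eps : R) m : measurable A ->
  (forall M, (m <= M)%N ->
    `|fine (Q (A `&` escape M)) - c * fine (Q (escape M))| <=
    eps * fine (Q (escape M))) ->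
  `|fine (Q (A `&` infinity_event E)) - c * fine (Q (infinity_event E))| <=
  eps * fine (Q (infinity_event E)).
Proof.
move=> mA h; have cA := @escape_cvg _ _ _ Q _ mA;
  have cT := @escape_cvgT _ _ E Q.
have cB : `|fine (Q (A `&` escape M))
  - c * fine (Q (escape M))| @[M --> \oo] -->
    `|fine (Q (A `&` infinity_event E)) - c * fine (Q (infinity_event E))|.
  by apply: cvg_norm; apply: cvgB => //; exact: cvgMr.
have cC : eps * fine (Q (escape M)) @[M --> \oo] -->
    eps * fine (Q (infinity_event E)) by exact: cvgMr.
by apply: (ler_cvg_to cB cC); exists m.
Qed.

Lemma escape_prob_le p q M : 0 <= p -> p <= q -> q <= 1 ->
  fine (P p (escape M)) <= fine (P q (escape M)).
Proof.
move=> p0 pq q1; apply: fine_le; rewrite ?fin_num_measure//;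
  try exact: measurable_escape.
apply: (bernoulli_increasing (finite_within_box E (M + L)) _ _ p0 pq q1).
- exact: determined_escape.
- by move=> w w'; exact: escape_increasing.
- by apply: bP; rewrite p0 (le_trans pq).
- by apply: bP; rewrite q1 (le_trans p0).
Qed.

(** Infinite connection is not local, so monotonicity in the parameter is proved for each escape
    event and passed to the limit. *)
Lemma infinity_prob_le p q : 0 <= p -> p <= q -> q <= 1 -> theta p <= theta q.
Proof.
move=> p0 pq q1; apply: ler_cvg_to (@escape_cvgT _ _ E (P p))
  (@escape_cvgT _ _ E (P q)) _.
by apply: nearW => M; exact: escape_prob_le.
Qed.

Lemma infinity_prob_le_escape (Q : probability (config E) R) M :
  fine (Q (infinity_event E)) <= fine (Q (escape M)).
Proof.
apply: fine_prob_le; [exact: measurable_infinity|exact: measurable_escape|].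
by rewrite infinity_eventE => w /(_ M I).
Qed.

Hypotheses (pc0 : 0 < pc) (pc1 : pc < 1) (iicP : iic (P pc) nu).

Let pc01 : 0 <= pc <= 1. Proof. by rewrite !ltW. Qed.

Lemma bernoulli_right_continuous (S : set E) (kappa : R)
  : finite_set S -> 0 < kappa ->
  exists2 delta, 0 < delta & forall p, pc < p -> p < pc + delta ->
    0 <= p <= 1 /\ forall G, determined S G ->
    `|fine (P p G) - fine (P pc G)| <= kappa.
Proof.
move=> fS k0; have [n nP] := bernoulli_lipschitz R fS.
(* The first bound keeps [p] at most 1; the second divides by [n.+1] because the Lipschitz constant
   [n] may be 0. *)
exists (Num.min (1 - pc) (kappa / n.+1%:R)).
  by rewrite lt_min subr_gt0 pc1 divr_gt0.
move=> p pcp; rewrite -ltrBlDl lt_min => /andP[p1 pd].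
have p01 : 0 <= p <= 1.
  by rewrite (ltW (lt_trans pc0 pcp)) ltW// -(ltrD2r (- pc)).
split=> // G dG; apply: (le_trans (nP _ _ _ _ p01 pc01 (bP p01) (bP pc01)
  G dG)).
have d0 : 0 <= p - pc by lra.
rewrite (ger0_norm d0); move: pd; rewrite ltr_pdivlMr// -natr1 => pd.
have n0 : 0 <= n%:R :> R by [].
nra.
Qed.

(** For large [n] and [p] near [pc], the probability of [escape n] exceeds [theta p] by little,
    because [theta p >= theta pc]. All errors are small multiples of [eps * theta pc], and the
    factor 8 leaves room for their sum. *)
Lemma cylinder_ratio_pos (J : seq E) w0 (eps : R) : 0 < eps -> eps <= 1 ->
  0 < theta pc ->
  exists2 delta, 0 < delta & forall p, pc < p -> p < pc + delta ->
    `|fine (P p (cylinder J w0 `&` infinity_event E)) -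
      fine (nu (cylinder J w0)) * theta p| <= 8 * eps * theta p.
Proof.
move=> e0 e1 th0; set F := cylinder J w0; set c := fine (nu F).
have mF : measurable F by exact: measurable_cylinder.
have [n1 n1P] := iic_uniform iicP J w0 e0.
have et : 0 < eps * theta pc by rewrite mulr_gt0.
have [n2 n2P] : exists n2, forall n, (n2 <= n)%N ->
    fine (P pc (escape n)) <= theta pc + eps * theta pc.
  have /cvgrPdist_le/(_ _ et)[n2 _ h] := @escape_cvgT _ _ E (P pc).
  exists n2 => n /h; rewrite ler_norml => /andP[+ _].
  rewrite -/(theta pc); move: (theta pc) (fine _) => t u.
  lra.
have [nJ JP] := edges_within_box J.
pose n := maxn nJ (maxn n1 n2).
have [nJn n1n n2n] : [/\ (nJ <= n)%N, (n1 <= n)%N & (n2 <= n)%N].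
  by rewrite !leq_max !leqnn !orbT.
have Jn : [set` J] `<=` within (box d (n + L)).
  by move=> e /JP h x /h; apply: box_leq; exact: leq_trans nJn (leq_addr _ _).
have dF : determined (within (box d (n + L))) F.
  by move=> w w' ww' Fw e eJ; rewrite Fw// ww'//; exact: Jn.
have dE : determined (within (box d (n + L))) (escape (E :=
  E) n) by exact: determined_escape.
have [delta d0 dP] := bernoulli_right_continuous (finite_within_box E (n + L))
  et.
exists delta => // p pcp pd; have [p01 pP] := dP p pcp pd.
have i1 : `|fine (P pc (F `&` escape n)) - c * fine (P pc (escape n))| <=
    eps * fine (P pc (escape n)).
  by apply: n1P => // x nx xn; apply: nx; exact: box_leq n1n _ xn.
have i2 := n2P n; have i3 := pP _ dE; have i4 := pP _ (determinedI dF dE).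
have i5 := infinity_prob_le (ltW pc0) (ltW pcp) (proj2 (andP p01)).
have i6 := infinity_prob_le_escape (P p) n.
have mI := measurable_infinity E.
have mE : measurable (escape (E := E) n) by exact: measurable_escape.
have i7 : fine (P p (F `&` infinity_event E)) <= fine (P p (F `&` escape n)).
  apply: fine_prob_le; [exact: measurableI|exact: measurableI|].
  by apply: setIS; rewrite infinity_eventE => w /(_ n I).
have i8 : fine (P p (F `&` escape n)) + theta p <=
    fine (P p (F `&` infinity_event E)) + fine (P p (escape n)).
  apply: fine_prob_setI_le => //.
  by rewrite infinity_eventE => w /(_ n I).
have c0 : 0 <= c by exact: fine_prob_ge0.
have c1 : c <= 1.
  by rewrite -lee_fin fineK ?fin_num_measure//; exact: probability_le1.
have {}i2 : fine (P pc (escape n)) <= theta pc + eps * theta pc by exact: i2.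
move: i1 i3 i4; rewrite !ler_norml => /andP[a1 a2] /andP[b1 b2] /andP[g1 g2].
rewrite -/(theta p) in i6 i8 *.
move: i2 i5 i6 i7 i8 a1 a2 b1 b2 g1 g2.
set ec := fine (P pc (escape n)); set ep := fine (P p (escape n)).
set fc := fine (P pc (F `&` _)); set fp := fine (P p (F `&` escape n)).
set fi := fine (P p (F `&` infinity_event E)).
set s := theta p; set t := theta pc; move: et; rewrite -/t.
set x := eps * t => x0 ecx ts sep fifp fps fc1 fc2 ep1 ep2 fp1 fp2.
have xs : x <= eps * s by rewrite /x ler_pM2l.
have ex : eps * ec <= x + x.
  apply: (@le_trans _ _ (eps * (t + x))); first by rewrite ler_pM2l.
  by rewrite mulrDr lerD2l ler_piMl// ltW.
have esx : ec - s <= x by rewrite lerBlDr (le_trans ecx)// addrC lerD2l.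
(* Since [ec] exceeds [s] by at most [x], weighting the difference by [c] or [1 - c] keeps this
   upper bound. *)
have bound a : 0 <= a -> a <= 1 -> a * (ec - s) <= x.
  move=> a0 a1; apply: (@le_trans _ _ (a * x)); first exact: ler_wpM2l.
  by rewrite ler_piMl// ltW.
have cx := bound c c0 c1.
have cx' : (1 - c) * (ec - s) <= x by apply: bound; rewrite ?subr_ge0// gerBl.
move: cx cx'; rewrite mulrBl mul1r !mulrBr.
move: (c * ec) (c * s) (eps * ec) ex xs fc1 fc2 =>
  ce cs ee ex xs fc1 fc2 cx cx'.
clear -x0 xs ex ecx ts sep fifp fps fc1 fc2 ep1 ep2 fp1 fp2 cx cx'.
rewrite -mulrA.
by apply/andP; split; lra.
Qed.


(** The constants are chosen in the order [n], [N], [kappa], [m], [delta], none of them depending on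
    [M]; this allows [M] to tend to infinity at fixed [p]. *)
Lemma cylinder_ratio_null (J : seq E) w0 (eps : R) : 0 < eps -> eps <= 1 ->
  theta pc = 0 ->
  exists2 delta, 0 < delta & forall p, pc < p -> p < pc + delta ->
    `|fine (P p (cylinder J w0 `&` infinity_event E)) -
      fine (nu (cylinder J w0)) * theta p| <= eps * theta p.
Proof.
move=> e0 e1 th0; set F := cylinder J w0; set c := fine (nu F).
have mF : measurable F by exact: measurable_cylinder.
have e20 : 0 < eps / 2 by rewrite divr_gt0.
have [n1 n1P] := iic_uniform iicP J w0 e20.
have [nJ JP] := edges_within_box J.
pose n := maxn nJ n1.
have [nJn n1n] : (nJ <= n)%N /\ (n1 <= n)%N by rewrite !leq_max !leqnn orbT.
have Jn : [set` J] `<=` within (box d n).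
  by move=> e /JP h x /h; exact: box_leq.
have [N NP] := bernoulli_all_open R (finite_within_box E (n + L)).
have pcN : 0 < pc ^+ N by rewrite exprn_gt0.
(* The local comparison costs [3 * kappa] and confinement to [box d m] costs [2 * kappa]. Multiplied
   by the probability of having a gate, at most [pc ^- N] times that of [escape M], this makes half
   of [eps]; the other half comes from [iic_uniform]. *)
pose kappa := eps * pc ^+ N / 10.
have k0 : 0 < kappa by rewrite divr_gt0// mulr_gt0.
have [m nm mP] : exists2 m, (n + L <= m)%N & fine (P pc (escape m)) <= kappa.
  have /cvgrPdist_le/(_ _ k0)[m _ h] := @escape_cvgT _ _ E (P pc).
  exists (m + (n + L))%N; first exact: leq_addl.
  have := h (m + (n + L))%N (leq_addr _ _); rewrite ler_norml => /andP[+ _].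
  by rewrite -/(theta pc) th0; move: (fine _) => t; lra.
have [delta d0 dP] := bernoulli_right_continuous (finite_within_box E (m + L))
  k0.
exists delta => // p pcp pd; have [p01 pP] := dP p pcp pd.
have c0 : 0 <= c by exact: fine_prob_ge0.
have c1 : c <= 1.
  by rewrite -lee_fin fineK ?fin_num_measure//; exact: probability_le1.
have esc2 : fine (P p (escape (E := E) m)) <= 2 * kappa.
  have := pP (escape m) (determined_escape EL).
  by move: mP; rewrite ler_norml => mP /andP[_]; lra.
apply: (@escape_limit_le _ _ _ _ m) => // M mM.
have n1nL : (n1 <= n + L)%N by exact: leq_trans n1n (leq_addr _ _).
have nmL : (n <= m + L)%N.
  by apply: leq_trans (leq_addr _ _); exact: leq_trans (leq_addr _ _) nm.
(* Three probabilities are moved between [p] and [pc], each at a cost of at most [kappa]. *)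
have hyp A V : A `<=` ~` box d (n + L) -> V `<=` ~` box d n ->
  `|fine (P p (F `&` [set w | joined_set w (box d m `\` A) 0 V])) -
    c * fine (P p [set w | joined_set w (box d m `\` A) 0 V])| <=
  eps / 2 * fine (P p [set w | joined_set w (box d m `\` A) 0 V]) + 3 * kappa.
  move=> nA nV; set G := [set w | _].
  have dG : determined (within (box d (m + L))) G.
    apply: determined_sub (@determined_joined_set _ E (box d m `\` A) 0 V).
    by move=> e eA x /eA[xm _]; exact: box_leq (leq_addr _ _) _ xm.
  have dF : determined (within (box d (m + L))) F.
    move=> w w' ww' Fw e eJ; rewrite Fw// ww'// => x xe.
    exact: box_leq nmL _ (Jn e eJ x xe).
  (* Removing [A] from [box d m] leaves [box d n1] intact, so the uniform estimate at [pc]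
     applies. *)
  have : `|fine (P pc (F `&` G))
    - c * fine (P pc G)| <= eps / 2 * fine (P pc G).
    apply: n1P => x; last by move=> /nV nx xn1; apply: nx;
      exact: box_leq n1n _ xn1.
    move=> xn; split; first exact: box_leq (leq_trans n1nL nm) _ xn.
    by move=> /nA; apply; exact: box_leq n1nL _ xn.
  have := pP _ dG; have := pP _ (determinedI dF dG).
  rewrite !ler_norml => /andP[a1 a2] /andP[b1 b2] /andP[g1 g2].
  move: a1 a2 b1 b2 g1 g2.
  move: (fine (P p G)) (fine (P pc G)) (fine (P p (F `&` G)))
    (fine (P pc (F `&` G))).
  move=> q q' r r' a1 a2 b1 b2 g1 g2.
  have scale a : 0 <= a -> a <= 1 -> a * (q - q') <= kappa /\ a * (q' - q)
    <= kappa.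
    move=> a0 a1'; split; apply: (@le_trans _ _ (a * kappa)).
    - exact: ler_wpM2l.
    - by rewrite ler_piMl// ltW.
    - by apply: ler_wpM2l => //; rewrite -opprB lerNl.
    - by rewrite ler_piMl// ltW.
  have [cq cq'] := scale c c0 c1.
  have e21 : eps / 2 <= 1 by rewrite ler_pdivrMr// mul1r (le_trans e1)// ler1n.
  have [_ eq'] := scale _ (ltW e20) e21.
  move: cq cq' eq' g1 g2; rewrite !mulrBr.
  move: (c * q) (c * q') (eps / 2 * q) (eps / 2 * q') => cq cq' hq hq'.
  move=> h1 h2 h3 h4 h5; clear -a1 a2 b1 b2 h1 h2 h3 h4 h5 k0.
  by apply/andP; split; lra.
have bp := bP p01.
have c01 : 0 <= c <= 1 by rewrite c0 c1.
have k30 : 0 <= 3 * kappa by rewrite mulr_ge0// ltW.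
have := exploration_bound EL p01 bp Jn nm mM c01 (ltW e20) k30 hyp.
move=> /le_trans; apply.
have kM : (n + L <= M)%N by exact: leq_trans nm mM.
have := doors_prob_le nnE EL p01 bp kM (NP _ _ p01 bp).
have pN : pc ^+ N <= p ^+ N by rewrite lerXn2r ?nnegrE ?ltW// (lt_trans pc0).
set D := [set w | gates _ _ _ w !=set0] => Dle.
have D0 := fine_prob_ge0 (P p) D; move: esc2 Dle D0; rewrite /kappa.
move: (fine (P p (escape m))) (fine (P p (escape M))) (fine (P p D)) => x y z.
move: pN pcN; move: (pc ^+ N) (p ^+ N) => a b ab a0 xa zy z0.
have h : eps * (a * z) <= eps * y.
  rewrite ler_pM2l//; apply: le_trans zy; rewrite mulrC.
  exact: ler_wpM2l.
have xz : x * z <= 2 * (eps * a / 10) * z by exact: ler_wpM2r.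
by move: h xz; lra.
Qed.

Lemma cylinder_ratio (J : seq E) w0 (eps : R) : 0 < eps ->
  exists2 delta, 0 < delta & forall p, pc < p -> p < pc + delta ->
    `|fine (P p (cylinder J w0 `&` infinity_event E)) -
      fine (nu (cylinder J w0)) * theta p| <= eps * theta p.
Proof.
move=> eps0; pose e := Num.min (eps / 8) 1.
have e0 : 0 < e by rewrite lt_min divr_gt0//=.
have e1 : e <= 1 by rewrite ge_min lexx orbT.
have e8 : 8 * e <= eps.
  have : e <= eps / 8 by rewrite ge_min lexx.
  by move=> h; lra.
have th p : 0 <= theta p by exact: fine_prob_ge0.
have [th0|th0] := ltP 0 (theta pc).
  have [delta d0 dP] := cylinder_ratio_pos J w0 e0 e1 th0.
  by exists delta => // p pcp pd; apply: (le_trans (dP p pcp pd));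
    rewrite ler_wpM2r.
have {}th0 : theta pc = 0 by apply/eqP; rewrite eq_le th0 th.
have [delta d0 dP] := cylinder_ratio_null J w0 e0 e1 th0.
exists delta => // p pcp pd; apply: (le_trans (dP p pcp pd));
  rewrite ler_wpM2r//.
by apply: le_trans e8; rewrite ler_peMl ?ltW//; lra.
Qed.

Hypothesis theta_gt0 : forall p, pc < p -> p <= 1 -> 0 < theta p.

Lemma conditioned_on_infinity_cvg :
  weak_cvg pc^'+ (fun p => cond_prob (P p) (measurable_infinity E)) nu.
Proof.
apply: cylinder_weak_cvg => J w0; apply/cvgrPdist_le => eps eps0.
have [delta d0 dP] := cylinder_ratio J w0 eps0.
near=> p.
have pcp : pc < p by near: p; exact: nbhs_right_gt.
have pd : p < pc + delta by near: p; apply: nbhs_right_lt; rewrite ltrDl.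
have p1 : p <= 1 by near: p; exact: nbhs_right_ltW.
have thp := theta_gt0 pcp p1.
rewrite cond_probE//; last exact: measurable_cylinder.
have := dP p pcp pd; rewrite -[fine (P p (infinity_event E))]/(theta p).
set a := fine _; set c := fine _ => h.
rewrite -(ler_pM2r thp); apply: le_trans h.
rewrite -[X in _ * X <= _](gtr0_norm thp) -normrM mulrBl divfK ?gt_eqF//.
by rewrite distrC.
Unshelve. all: end_near. Qed.

End right_limit.

(** * The critical probability *)

Section critical_point.
Context (R : realType) (d : nat) (E : set {fset Zd d}).
Variables (L : nat) (P : R -> probability (config E) R).
Hypotheses (nnE : contains_nearest_neighbors E) (EL : edge_range E L).
Hypothesis bP : forall p : R, 0 <= p <= 1 -> bernoulli_product p (P p).
Hypothesis d6 : (6 < d)%N.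

Let pc := critical_probability P.

(** This is the diagonal point with all coordinates equal to [n]: it lies in [box d n] and has
    Euclidean norm at least [n]. *)
Definition axis_point (n : nat) : Zd d := const_mx n%:Z.

Lemma axis_point_box n : box d n (axis_point n).
Proof. by apply/boxP => i; rewrite mxE. Qed.

Lemma axis_point_neq0 n : axis_point n.+1 != 0.
Proof.
have i : 'I_d := Ordinal (leq_trans (ltn0Sn 6) d6).
by apply/eqP => /rowP/(_ i); rewrite !mxE.
Qed.

Lemma norm2_axis_point n : n%:R <= norm2 R (axis_point n).
Proof.
pose i : 'I_d := Ordinal (leq_trans (ltn0Sn 6) d6).
rewrite -[leLHS]ger0_norm// -sqrtr_sqr /norm2 ler_sqrt; last first.
  by apply: sumr_ge0 => j _; rewrite sqr_ge0.
rewrite (bigD1 i)//= mxE lerDl; apply: sumr_ge0 => j _; exact: sqr_ge0.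
Qed.

(** Since [6 < d], the exponent is at most -1, and the norm is at least [n.+1]. *)
Lemma norm2_pow_axis_point n :
  0 < norm2_pow R (axis_point n.+1) (2 - d%:Z) <= n.+1%:R^-1.
Proof.
rewrite /norm2_pow (negbTE (axis_point_neq0 n)).
have h := norm2_axis_point n.+1.
have h0 : 0 < norm2 R (axis_point n.+1) by apply: lt_le_trans h.
rewrite exprz_gt0//=.
have -> : 2 - d%:Z = - (d - 2)%N%:Z by lia.
rewrite -exprnN -exprVn.
have [k ->] : exists k, (d - 2)%N = k.+1 by exists (d - 3)%N; lia.
have i1 : (norm2 R (axis_point n.+1))^-1 <=
  n.+1%:R^-1 by rewrite lef_pV2// posrE.
have v0 : 0 <= (norm2 R (axis_point n.+1))^-1 by rewrite invr_ge0 ltW.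
have v1 : (norm2 R (axis_point n.+1))^-1 <= 1.
  by rewrite invf_le1//; apply: le_trans h; rewrite ler1n.
by rewrite exprS; apply: le_trans i1; rewrite ler_piMr// exprn_ile1.
Qed.

Let good := [set p | 0 <= p <= 1 /\
  (0 < P p [set w | infinite_set (Defs.cluster w 0)])%E].

Lemma critical_probability_itv : 0 <= pc <= 1.
Proof.
rewrite /pc /critical_probability -/good.
(* The infimum of the empty set is 0 by convention. *)
have [->|/set0P g0] := eqVneq good set0; first by rewrite inf0 lexx ler01.
have lb : lbound good 0 by move=> p [/andP[]].
rewrite lb_le_inf//=; have [p gp] := g0.
apply: le_trans (ge_inf _ gp) _; first by exists 0.
by case: gp => /andP[].
Qed.

Lemma no_escape_closed : P 0 (escape (E := E) 0) = 0%E.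
Proof.
have b0 : bernoulli_product 0 (P 0) by apply: bP; rewrite lexx ler01.
apply: (bernoulli_zero b0 (finite_within_box E (0 + L))).
  exact: determined_escape.
move=> [y ny wy]; have [u [v [_ /asboolP[e [_]]]]] :=
  first_exit wy (@box0 d 0) ny.
by [].
Qed.

Lemma joined_box_open n x : box d n x ->
  P 1 [set w : config E | joined w (box d n) 0 x] = 1%E.
Proof.
move=> nx; have b1 : bernoulli_product 1 (P 1) by apply: bP; rewrite lexx ler01.
apply: (bernoulli_one b1 (finite_within_box E n));
  first exact: determined_joined.
exact: box_connected.
Qed.

Lemma measurable_connect_event x y : measurable (connect_event E x y).
Proof. exact: measurable_joined. Qed.

(** At parameter 0 the origin is almost surely joined to no other vertex, against the lower
    two-point bound. *)
Lemma critical_probability_gt0 : two_point_estimates (P pc) -> 0 < pc.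
Proof.
have /andP[pc0 _] := critical_probability_itv.
move=> [c [C [/andP[c0 _] h]]]; rewrite lt_neqAle pc0 andbT eq_sym.
apply/eqP => pcE.
have [+ _] := andP (h (axis_point 1)); rewrite leNgt => /negP; apply.
have [/andP[n0 _]] := norm2_pow_axis_point 0.
apply: (@le_lt_trans _ _ 0%E); last by rewrite lte_fin mulr_gt0.
rewrite pcE -no_escape_closed; apply: le_measure; rewrite ?inE.
- exact: measurable_connect_event.
- exact: measurable_escape.
move=> w wx; exists (axis_point 1) => // x0.
have := axis_point_neq0 0; apply/negP/negPn/eqP/rowP => i.
by move/boxP : x0 => /(_ i); rewrite leqn0 absz_eq0 => /eqP ->; rewrite mxE.
Qed.

(** At parameter 1 every vertex is almost surely joined to 0, while the upper two-point bound is
    below 1 far away. *)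
Lemma critical_probability_lt1 : two_point_estimates (P pc) -> pc < 1.
Proof.
have /andP[_ pc1] := critical_probability_itv.
move=> [c [C [/andP[c0 cC] h]]]; rewrite lt_neqAle pc1 andbT.
apply/eqP => pcE.
pose n := Num.truncn C; have Cn : C < n.+1%:R by rewrite -truncn_le_nat.
have [_] := andP (h (axis_point n.+1)); rewrite leNgt => /negP; apply.
have C0 : 0 < C by exact: lt_trans cC.
apply: (@lt_le_trans _ _ 1%E).
  have /andP[n0 n1] := norm2_pow_axis_point n.
  rewrite lte_fin; apply: (@le_lt_trans _ _ (C / n.+1%:R));
    first by rewrite ler_pM2l.
  by rewrite ltr_pdivrMr// mul1r.
rewrite pcE -(joined_box_open (axis_point_box n.+1)); apply: le_measure;
  rewrite ?inE.
- exact: measurable_joined.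
- exact: measurable_connect_event.
by move=> w; exact: joined_subset.
Qed.

(** As [pc] is positive, it is the infimum of a nonempty set; some parameter of that set lies below
    [p], and monotonicity concludes. *)
Lemma infinity_prob_gt0 p : 0 < pc -> pc < p -> p <= 1 ->
  0 < fine (P p (infinity_event E)).
Proof.
move=> pc0 pcp p1; have g0 : good !=set0.
  apply/set0P/eqP => gE; move: pc0.
  by rewrite /pc /critical_probability -/good gE inf0 ltxx.
have [q [/andP[q0 q1] qpos] qp] := inf_lt g0 pcp.
apply: lt_le_trans (infinity_prob_le EL bP q0 (ltW qp) p1).
move: qpos; rewrite infinite_clusterE => qpos.
by rewrite -lte_fin fineK ?fin_num_measure//; exact: measurable_infinity.
Qed.

End critical_point.

Theorem theorem1p2 (R : realType) (d : nat) (E : set {fset 'rV[int]_d})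
    (P : R -> probability (config E) R) (nu : probability (config E) R) :
  (6 < d)%N ->
  (E = nearest_neighbor d \/
   exists Lambda : R, 1 <= Lambda /\ E = spread_out d Lambda) ->
  (forall p : R, 0 <= p <= 1 -> bernoulli_product p (P p)) ->
  two_point_estimates (P (critical_probability P)) ->
  iic (P (critical_probability P)) nu ->
  weak_cvg (critical_probability P)^'+
    (fun p => cond_prob (P p) (measurable_infinity E)) nu.
Proof.
move=> d6 /edge_setP[nnE [L EL]] bP tp iicP.
have pc0 := critical_probability_gt0 EL bP d6 tp.
have pc1 := critical_probability_lt1 nnE bP d6 tp.
apply: (conditioned_on_infinity_cvg nnE EL bP pc0 pc1 iicP) => p pcp p1.
exact: infinity_prob_gt0 EL bP _ pc0 pcp p1.
Qed.
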